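(* Let $T_n$ be the number of rooted planar triangulations (without boundary) with $n$ vertices, and let $\mathfrak{T}(x)=\sum_{n\geq 2}T_n x^n$ and $\mathfrak{T}^{\bullet}(x)=x\,\mathfrak{T}'(x)$. Then, as formal power series in $x$, $$3\mathfrak{T}^{\bullet}-4\mathfrak{T}=2\left(\frac{\mathfrak{T}^{\bullet}-\mathfrak{T}}{1-\mathfrak{T}^{\bullet}/x}\right).$$ Assuming $T_2=1$, this equation characterizes $\mathfrak{T}$ (i.e. $\mathfrak{T}$ is its unique solution in $x^2\mathbb{Q}[[x]]$ with coefficient of $x^2$ equal to $1$), and it is equivalent to the following recursion: for every $n\geq 3$, $$T_n=\frac{1}{n-2}\sum_{k=2}^{n-1}(3k-4)(n+1-k)\,T_k\,T_{n+1-k}.$$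
   Context: A planar map is a finite connected graph (loops and multiple edges allowed) properly embedded in the two-dimensional sphere, considered up to continuous (orientation-preserving) deformation. It is rooted if an oriented edge is distinguished. The degree of a face is the number of edges incident to it, i.e. the number of sides of its underlying polygon (an edge with the same face on both sides is counted twice). A (rooted, planar) triangulation is a rooted planar map all of whose faces have degree $3$. By convention, the map consisting of two vertices linked by a single edge is considered to be a triangulation without boundary (with $0$ faces), so that $T_2=1$; the series starts $\mathfrak{T}(x)=x^2+4x^3+32x^4+336x^5+\cdots$. For a series in $x^2\mathbb{Q}[[x]]$, the series $\mathfrak{T}^{\bullet}/x$ has zero constant term, so $1-\mathfrak{T}^{\bullet}/x$ is invertible in $\mathbb{Q}[[x]]$. *)

(* Defs.v *)
From HB Require Import structures.
From mathcomp Require Import all_boot all_order all_algebra all_fingroup.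
From mathcomp Require Import boolp.
From mathcomp Require Import zify.

Set Implicit Arguments.
Unset Strict Implicit.
Unset Printing Implicit Defensive.

Import GRing.Theory.

Local Open Scope ring_scope.

Record fps (R : Type) := Fps { coefs : nat -> R }.

HB.instance Definition _ (R : Type) := gen_eqMixin (fps R).
HB.instance Definition _ (R : Type) := gen_choiceMixin (fps R).

Section FpsRing.
Variable R : comUnitRingType.
Implicit Types f g h : fps R.

Lemma fpsP f g : coefs f =1 coefs g -> f = g.
Proof. by case: f g => [u] [v] /= /funext ->. Qed.

Definition fps0 : fps R := Fps (fun=> 0).
Definition fps1 : fps R := Fps (fun n => (n == 0%N)%:R).
Definition fps_opp f := Fps (fun n => - coefs f n).
Definition fps_add f g := Fps (fun n => coefs f n + coefs g n).
Definition fps_mul f g :=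
  Fps (fun n => \sum_(i < n.+1) coefs f i * coefs g (n - i)%N).

Fact fps_addA : associative fps_add.
Proof. by move=> f g h; apply/fpsP=> n; rewrite /= addrA. Qed.
Fact fps_addC : commutative fps_add.
Proof. by move=> f g; apply/fpsP=> n; rewrite /= addrC. Qed.
Fact fps_add0 : left_id fps0 fps_add.
Proof. by move=> f; apply/fpsP=> n; rewrite /= add0r. Qed.
Fact fps_addN : left_inverse fps0 fps_opp fps_add.
Proof. by move=> f; apply/fpsP=> n; rewrite /= addNr. Qed.

HB.instance Definition _ :=
  GRing.isZmodule.Build (fps R) fps_addA fps_addC fps_add0 fps_addN.

Let trunc N f : {poly R} := \poly_(i < N) coefs f i.

Let coef_trunc N f n : (n < N)%N -> (trunc N f)`_n = coefs f n.
Proof. by move=> ltnN; rewrite coef_poly ltnN. Qed.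

Let coef_mul N f g n : (n < N)%N ->
  coefs (fps_mul f g) n = (trunc N f * trunc N g)`_n.
Proof.
move=> ltnN; rewrite coefM /=; apply: eq_bigr => i _.
by rewrite !coef_trunc // (leq_ltn_trans _ ltnN) ?leq_subr // -ltnS.
Qed.

Fact fps_mulA : associative fps_mul.
Proof.
move=> f g h; apply/fpsP=> n.
transitivity (trunc n.+1 f * (trunc n.+1 g * trunc n.+1 h))`_n.
  rewrite coefM; apply: eq_bigr => i _.
  by rewrite coef_trunc // (@coef_mul n.+1) // ltnS leq_subr.
rewrite mulrA coefM; apply: eq_bigr => i _.
by rewrite (@coef_mul n.+1) // coef_trunc // ltnS leq_subr.
Qed.

Fact fps_mulC : commutative fps_mul.
Proof.
by move=> f g; apply/fpsP=> n; rewrite !(@coef_mul n.+1) // mulrC.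
Qed.

Fact fps_mul1 : left_id fps1 fps_mul.
Proof.
move=> f; apply/fpsP=> n /=; rewrite big_ord_recl /= subn0 mul1r.
by rewrite big1 ?addr0 // => i _; rewrite mul0r.
Qed.

Fact fps_mulDl : left_distributive fps_mul fps_add.
Proof.
move=> f g h; apply/fpsP=> n /=; rewrite -big_split.
by apply: eq_bigr => i _; rewrite mulrDl.
Qed.

Fact fps1_neq0 : fps1 != fps0.
Proof.
apply/eqP=> /(congr1 (fun f => coefs f 0%N)) /= /eqP.
by rewrite (negPf (oner_neq0 _)).
Qed.

HB.instance Definition _ := GRing.Zmodule_isComNzRing.Build (fps R)
  fps_mulA fps_mulC fps_mul1 fps_mulDl fps1_neq0.

(* The list of the first n coefficients of the inverse of f.                  *)
Fixpoint inv_coefs f n : seq R :=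
  if n is m.+1 then
    let s := inv_coefs f m in
    rcons s ((coefs f 0)^-1 *
      ((m == 0%N)%:R - \sum_(i < m) s`_i * coefs f (m - i)%N))
  else [::].

Definition fps_unit : {pred fps R} := fun f => coefs f 0 \is a GRing.unit.

(* As for all unit rings, inversion is the identity on nonunits.              *)
Definition fps_inv f :=
  if f \in fps_unit then Fps (fun n => (inv_coefs f n.+1)`_n) else f.

Let size_inv_coefs f n : size (inv_coefs f n) = n.
Proof. by elim: n => //= n IHn; rewrite size_rcons IHn. Qed.

Let nth_inv_coefs f n i : (i < n)%N ->
  (inv_coefs f n)`_i = (inv_coefs f i.+1)`_i.
Proof.
elim: n => // n IHn; rewrite ltnS leq_eqVlt => /predU1P[-> // | ltin].
by rewrite [inv_coefs f n.+1]/= nth_rcons size_inv_coefs ltin IHn.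
Qed.

Fact fps_mulV : {in fps_unit, left_inverse 1 fps_inv *%R}.
Proof.
move=> f Uf; rewrite /fps_inv Uf; apply/fpsP=> n.
have Uf0 : coefs f 0 \is a GRing.unit by [].
transitivity (\sum_(i < n.+1) (inv_coefs f i.+1)`_i * coefs f (n - i)%N) => //.
rewrite big_ord_recr subnn /= nth_rcons size_inv_coefs ltnn eqxx.
have -> : \sum_(i < n) (inv_coefs f i.+1)`_i * coefs f (n - i)%N =
          \sum_(i < n) (inv_coefs f n)`_i * coefs f (n - i)%N.
  by apply: eq_bigr => i _; rewrite (nth_inv_coefs f (ltn_ord i)).
by rewrite [_ * coefs f 0]mulrC mulVKr // [LHS]addrC subrK.
Qed.

Fact fps_unitP f g : g * f = 1 -> f \in fps_unit.
Proof.
move=> /(congr1 (fun h => coefs h 0%N)) /=; rewrite big_ord1 => gf1.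
by apply/unitrPr; exists (coefs g 0); rewrite mulrC.
Qed.

Fact fps_inv_out : {in [predC fps_unit], fps_inv =1 id}.
Proof. by move=> f; rewrite inE /= /fps_inv => /negPf->. Qed.

HB.instance Definition _ := GRing.ComNzRing_hasMulInverse.Build (fps R)
  fps_mulV fps_unitP fps_inv_out.

Definition fpsX : fps R := Fps (fun n => (n == 1%N)%:R).
Definition fps_deriv f := Fps (fun n => coefs f n.+1 *+ n.+1).

(* The quotient f / x of a series f with zero constant term; x is not a unit  *)
(* of R[[x]], so this is not an instance of the ring division.                *)
Definition fps_divX f := Fps (fun n => coefs f n.+1).

Lemma fps_mulX f : fpsX * f = Fps (fun n => if n is m.+1 then coefs f m else 0).
Proof.
apply/fpsP=> -[|n] /=; first by rewrite big_ord1 mul0r.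
rewrite big_ord_recl mul0r add0r big_ord_recl mul1r subSS subn0.
by rewrite big1 ?addr0 // => i _; rewrite mul0r.
Qed.

Lemma fps_divXK f : coefs f 0 = 0 -> fpsX * fps_divX f = f.
Proof. by move=> f0; rewrite fps_mulX; apply/fpsP=> -[|n] /=. Qed.

Definition pointed f := fpsX * fps_deriv f.

Definition in_x2 f := coefs f 0 = 0 /\ coefs f 1 = 0.

Lemma unit_1B_pointed f :
  in_x2 f -> 1 - fps_divX (pointed f) \is a GRing.unit.
Proof.
case=> _ f1; suff -> : (1 - fps_divX (pointed f) \is a GRing.unit) =
  (coefs (1 - fps_divX (pointed f)) 0 \is a GRing.unit) by
  rewrite /pointed fps_mulX /= f1 mulr1n subr0 unitr1.
by [].
Qed.

End FpsRing.

Arguments fpsX {R}.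

(* Rooted maps as rotation systems. The elements of D are the darts (oriented *)
(* edges): vrot is the rotation of the darts counterclockwise around their    *)
(* origin, opp reverses a dart, root_dart is the distinguished oriented edge.  *)
(* Vertices, edges and faces are the cycles of vrot, opp and frot.            *)

Record rooted_map (D : finType) :=
  RootedMap { vrot : {perm D}; opp : {perm D}; root_dart : D }.

Section RootedMaps.
Variable D : finType.
Implicit Types (M : rooted_map D) (p : {perm D}).

Definition rooted_map_tuple M := (vrot M, opp M, root_dart M).
Definition tuple_rooted_map (t : {perm D} * {perm D} * D) :=
  RootedMap t.1.1 t.1.2 t.2.
Fact rooted_map_tupleK : cancel rooted_map_tuple tuple_rooted_map.
Proof. by case. Qed.

HB.instance Definition _ :=
  Finite.copy (rooted_map D) (can_type rooted_map_tupleK).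

(* frot M d = vrot M (opp M d), as (s * t) d = t (s d) for permutations.     *)
Definition frot M : {perm D} := (opp M * vrot M)%g.

Definition num_vertices M := #|porbits (vrot M)|.
Definition num_edges M := #|porbits (opp M)|.
Definition num_faces M := #|porbits (frot M)|.

Definition edge_involution M :=
  [forall d, (opp M d != d) && (opp M (opp M d) == d)].

Definition connected_map M :=
  [forall d, connect (fun a b => (b == vrot M a) || (b == opp M a))
                     (root_dart M) d].

(* The surface carrying the map is a sphere: V - E + F = 2.                   *)
Definition planar_map M :=
  [&& edge_involution M, connected_map M &
      (num_vertices M + num_faces M == num_edges M + 2)%N].

(* The second disjunct is the map made of two vertices linked by one edge,    *)
(* conventionally a triangulation.                                            *)
Definition triangulation M :=
  planar_map M &&
  ([forall d, #|porbit (frot M) d| == 3%N] ||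
   ((num_vertices M == 2%N) && (num_edges M == 1%N))).

Definition relabel p M :=
  RootedMap (vrot M ^ p)%g (opp M ^ p)%g (p (root_dart M)).

Definition isomorphic M M' := [exists p : {perm D}, M' == relabel p M].

Lemma isomorphic_equiv : equivalence_rel isomorphic.
Proof.
have refl M : isomorphic M M.
  by apply/existsP; exists 1%g; case: M => v o r; rewrite /relabel !conjg1 perm1.
have sym M M' : isomorphic M M' -> isomorphic M' M.
  case/existsP=> p /eqP->; apply/existsP; exists p^-1%g.
  by case: M => v o r; rewrite /relabel /= !conjgK permK.
have trans M M' M'' : isomorphic M M' -> isomorphic M' M'' -> isomorphic M M''.
  case/existsP=> p /eqP-> /existsP[q /eqP->]; apply/existsP; exists (p * q)%g.
  by case: M => v o r; rewrite /relabel /= !conjgM permM.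
move=> M M' M''; split=> // MM'; apply/idP/idP; last exact: trans.
by apply: trans; apply: sym.
Qed.

Definition triangulations n : {set rooted_map D} :=
  [set M | triangulation M & num_vertices M == n].

End RootedMaps.

(* A map with m edges has 2m darts, so each class of rooted triangulations    *)
(* with n vertices and m edges is represented on 'I_m.*2.                     *)
Definition num_triangulations_edges (n m : nat) : nat :=
  #|equivalence_partition (@isomorphic 'I_m.*2) (triangulations _ n)|.

(* The bound on the number m of edges loses nothing: see triangulation_edges. *)
Definition num_triangulations (n : nat) : nat :=
  (\sum_(m < 3 * n) num_triangulations_edges n m)%N.

Lemma card_porbits_const (D : finType) (s : {perm D}) k :
  (forall d, #|porbit s d| = k) -> #|D| = (#|porbits s| * k)%N.
Proof.
move=> sk; have /card_partition : partition (porbits s) [set: D].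
  have -> : porbits s = equivalence_partition (fun x y => x \in porbit s y) setT.
    apply/setP=> A; apply/imsetP/imsetP=> [] [d _ ->]; exists d => //.
      by apply/setP=> x; rewrite !inE porbit_sym.
    by apply/setP=> x; rewrite !inE porbit_sym.
  apply: equivalence_partitionP => x y z _ _ _; split; first exact: porbit_id.
  by rewrite -eq_porbit_mem => /eqP; rewrite -!eq_porbit_mem => ->.
rewrite cardsT => ->; rewrite -sum_nat_const.
by apply: eq_bigr => A /imsetP[d _ ->].
Qed.

Lemma num_edges_double (D : finType) (M : rooted_map D) :
  edge_involution M -> #|D| = (num_edges M).*2.
Proof.
move/forallP=> inv; rewrite -muln2; apply: card_porbits_const => d.
have /andP[ne /eqP oo] := inv d.
suff -> : porbit (opp M) d = [set d; opp M d] by rewrite cards2 eq_sym ne.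
apply/setP=> x; rewrite !inE; apply/porbitP/orP=> [[i ->] | []/eqP->]; last first.
- by exists 1%N; rewrite expg1.
- by exists 0%N; rewrite expg0 perm1.
elim: i => [|i [] /eqP IHi]; first by left; rewrite expg0 perm1.
  by right; rewrite expgSr permM IHi.
by left; rewrite expgSr permM IHi oo.
Qed.

Lemma triangulation_edges (m n : nat) (M : rooted_map 'I_m.*2) :
  triangulation M -> num_vertices M = n ->
  if n == 2%N then m = 1%N else (m + 6 = 3 * n)%N.
Proof.
case/andP=> /and3P[inv _ /eqP euler] tri Mn.
have := num_edges_double inv; rewrite card_ord => mE.
have {}mE : m = num_edges M by lia.
have r := root_dart M.
have m_gt0 : (0 < m)%N by case: (m) r => [|//] [].
case/orP: tri => [/forallP deg3 | /andP[/eqP V2 /eqP E1]].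
  have := @card_porbits_const _ (frot M) 3 (fun d => eqP (deg3 d)).
  rewrite card_ord -/(num_faces M) => dF.
  by case: eqP => n2; lia.
by rewrite -Mn V2 eqxx; lia.
Qed.

Definition triangulation_series : fps rat :=
  Fps (fun n => if (2 <= n)%N then (num_triangulations n)%:R else 0).

Definition triangulation_equation (F : fps rat) : Prop :=
  3 * pointed F - 4 * F =
  2 * ((pointed F - F) / (1 - fps_divX (pointed F))).

Definition triangulation_recursion (t : nat -> rat) : Prop :=
  forall n : nat, (3 <= n)%N ->
    t n = (n%:R - 2)^-1 *
          \sum_(2 <= k < n) (3 * k%:R - 4) * (n.+1 - k)%:R * t k * t (n.+1 - k)%N.

(* Main.v *)
(* Deleting the root edge of a rooted planar map with an outer face of degree   *)
(* p and triangular inner faces either merges the outer face with a triangle,   *)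
(* which leaves an outer face of degree p + 1, or yields two maps whose outer   *)
(* degrees add up to p - 2. With x marking the vertices and z the outer degree, *)
(* this is Tutte's equation                                                     *)
(*         z^3 W^2 + (1 - z) W = (1 - z) x + z W_1,                             *)
(* where W_1 = T because deleting the root edge twice, starting from p = 1,     *)
(* leads to p = 3 (the product term only occurs for two vertices, where it      *)
(* accounts for T_2 = 1). Differentiating in x,                                 *)
(*         (2 z^3 W + 1 - z) dW/dx = 1 - z (1 - T'),                            *)
(* so that the first factor vanishes at z = 1 / (1 - T'). Eliminating W gives   *)
(* Clairaut's equation  T'^2 (1 - T')^2 = 4 (x T' - T),  and differentiating    *)
(* again yields x as a polynomial in T'; the claim is then an identity in T'.   *)
(* The recursion is the equation read coefficientwise.                          *)
(*                                                                              *)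
(* Maps are counted with labelled darts: rooted connected maps have no          *)
(* automorphism, so an isomorphism class on n darts has n! representatives.     *)
(* All the maps met in the induction live on subsets of one set of darts, the   *)
(* two permutations being extended by the identity; cutting an edge and         *)
(* removing a dart are then products with a transposition, and the Euler        *)
(* inequality for pairs of permutations decides when an edge is a bridge.       *)

From HB Require Import structures.
Require Import Defs.
From mathcomp Require Import all_boot all_order all_algebra all_fingroup.
From mathcomp Require Import zify ring.

Set Implicit Arguments.
Unset Strict Implicit.
Unset Printing Implicit Defensive.

(** * Classes of an equivalence relation *)

Section EquivalenceClasses.
Variable D : finType.
Implicit Types (R : rel D) (X : {set D}) (a b x y : D).

(** A rooted triangulation with more than two vertices is a disk of outer degree 3, where a disk is
    a rooted planar map whose faces other than the outer one are triangles. Deleting the root edge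
    of a disk of outer degree p gives a disk of outer degree p + 1 if the edge borders a triangle,
    and two disks if it is a bridge ([card_triangles], [card_bridges]). Topology enters through
    permutations alone: [euler_inequality] says that the genus is nonnegative, and [planar_cut]
    derives from it that in genus zero an edge is a bridge exactly when both its sides lie on one
    face.

    Rooted connected maps have no nontrivial automorphism ([relabel_inj]), so unlabelled counts are
    labelled counts divided by a factorial; [card_stub_maps] and [card_classes] thus turn the
    bijections into the recursion of [stub_count]. As Euler's formula fixes the number of darts
    ([stub_count_support]), the same numbers can be indexed by vertices. They form a series W(x, z)
    subject to the quadratic equation [disk_equation], whose other unknown is T, the part of W of
    outer degree 1 ([num_triangulations_disk]).

    The kernel method eliminates W: at z = 1 / (1 - T') the equation and its derivative in x give
    [clairaut], and a further derivative expresses x as a polynomial in T' ([fpsX_derivE]). The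
    claimed equation becomes a polynomial identity in T'. Read coefficientwise it says that (n - 2)
    T_n is the sum in the recursion ([triangulation_equationP]), which determines every coefficient
    from T_2 and hence gives uniqueness. *)

Definition num_classes R := #|[set [set y | R x y] | x in D]|.

Definition join_classes R a b : rel D :=
  fun x y => [|| R x y, R x a && R b y | R x b && R a y].

Lemma eq_num_classes R1 R2 : R1 =2 R2 -> num_classes R1 = num_classes R2.
Proof.
move=> eqR; rewrite /num_classes; congr #|pred_of_set _|.
by apply: eq_imset => x; apply/setP=> y; rewrite !inE.
Qed.

Lemma num_classes_le R : num_classes R <= #|D|.
Proof. exact: leq_imset_card. Qed.

Section Equivalence.
Variable R : rel D.
Hypotheses (Rrefl : reflexive R) (Rsym : symmetric R) (Rtrans : transitive R).

Lemma class_eqP x y : [set z | R x z] = [set z | R y z] <-> R x y.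
Proof.
split=> [/setP/(_ y)|xy]; first by rewrite !inE Rrefl.
apply/setP=> z; rewrite !inE; apply/idP/idP; last exact: Rtrans.
by apply: Rtrans; rewrite Rsym.
Qed.

Lemma num_classes_split X : (forall x y, R x y -> (x \in X) = (y \in X)) ->
  num_classes R = #|[set [set y | R x y] | x in X]|
                  + #|[set [set y | R x y] | x in ~: X]|.
Proof.
move=> XR; rewrite -cardsUI -imsetU -[LHS]addn0; congr (_ + _).
  congr #|pred_of_set _|; apply/setP=> Y.
  by apply/imsetP/imsetP=> -[x _ ->]; exists x; rewrite // setUCr inE.
apply/esym/eqP; rewrite cards_eq0 -subset0; apply/subsetP=> Y.
rewrite inE => /andP[/imsetP[x xX ->] /imsetP[y yX /class_eqP/XR]].
by move: yX; rewrite inE xX => /negPf->.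
Qed.

Lemma join_classes_sym a b : symmetric (join_classes R a b).
Proof.
move=> x y; rewrite /join_classes (Rsym x y); congr (_ || _).
by rewrite orbC !(Rsym x) !(Rsym _ y); congr (_ || _); rewrite andbC.
Qed.

Lemma join_classes_trans a b : transitive (join_classes R a b).
Proof.
move=> y x z; rewrite /join_classes.
case/or3P=> [xy|/andP[xa by_]|/andP[xb ay]] /or3P[yz|/andP[ya bz]|/andP[yb az]];
  apply/or3P.
- by constructor 1; apply: Rtrans yz.
- by constructor 2; rewrite (Rtrans xy ya).
- by constructor 3; rewrite (Rtrans xy yb).
- by constructor 2; rewrite xa (Rtrans by_ yz).
- by constructor 2; rewrite xa.
- by constructor 1; apply: Rtrans az.
- by constructor 3; rewrite xb (Rtrans ay yz).
- by constructor 1; apply: Rtrans bz.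
- by constructor 3; rewrite xb.
Qed.

End Equivalence.

(** Outside the union [X] of the classes of a and b the two relations have the same classes; inside,
    the classes of a and b are replaced by the single class [X]. *)
Lemma num_classes_join R1 R2 a b :
  reflexive R1 -> symmetric R1 -> transitive R1 ->
  R2 =2 join_classes R1 a b -> num_classes R1 = num_classes R2 + ~~ R1 a b.
Proof.
move=> r1 s1 t1 e2; have [ab|nab] := boolP (R1 a b).
  rewrite addn0; apply: eq_num_classes => x y; rewrite e2 /join_classes.
  apply/idP/or3P=> [->|]; first by constructor 1.
  case=> // /andP[xc cy]; apply: (t1 _ _ _ xc); apply: (t1 _ _ _ _ cy) => //.
  by rewrite s1.
rewrite (eq_num_classes e2).
pose X := [set x | R1 x a || R1 x b].
have X1 x y : R1 x y -> (x \in X) = (y \in X).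
  move=> xy; rewrite !inE; apply/orP/orP=> -[] H.
  - by left; apply: (t1 _ _ _ _ H); rewrite s1.
  - by right; apply: (t1 _ _ _ _ H); rewrite s1.
  - by left; apply: (t1 _ _ _ _ H).
  - by right; apply: (t1 _ _ _ _ H).
have r2 : reflexive (join_classes R1 a b) by move=> x; rewrite /join_classes r1.
have s2 := join_classes_sym s1 a b.
have t2 := @join_classes_trans _ t1 a b.
have X2 x y : join_classes R1 a b x y -> (x \in X) = (y \in X).
  case/or3P; [exact: X1| |] => /andP[xa yb]; rewrite !inE xa (s1 y).
    by rewrite (s1 y b) yb !orbT.
  by rewrite yb orbT.
rewrite (num_classes_split r1 s1 t1 X1) (num_classes_split r2 s2 t2 X2).
rewrite addnAC; congr (_ + _); last first.
  congr #|pred_of_set _|; apply: eq_in_imset => x xX; apply/setP=> y.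
  move: xX; rewrite !inE negb_or /join_classes => /andP[/negPf-> /negPf->].
  by rewrite orbF.
have -> : [set [set y | R1 x y] | x in X] = [set [set y | R1 a y]; [set y | R1 b y]].
  apply/setP=> Y; rewrite !inE; apply/imsetP/orP=> [[x xX ->]|].
    move: xX; rewrite inE => /orP[] H; [left|right]; apply/eqP/class_eqP=> //.
  by case=> /eqP->; [exists a|exists b]; rewrite // inE r1 ?orbT.
have -> : [set [set y | join_classes R1 a b x y] | x in X] = [set X].
  apply/setP=> Y; rewrite !inE; apply/imsetP/eqP=> [[x xX ->]|->].
    apply/setP=> y; rewrite inE; apply/idP/idP=> [/X2<- //|].
    move: xX; rewrite !inE /join_classes !(s1 y) => /orP[] H /orP[] H'.
    + by rewrite (t1 _ _ _ H H').
    + by rewrite H H' orbT.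
    + by rewrite H H' !orbT.
    + by rewrite (t1 _ _ _ H H').
  exists a; first by rewrite inE r1.
  apply/setP=> y; rewrite !inE /join_classes r1 (negPf nab) orbF.
  by rewrite /= (s1 y) (s1 y b).
rewrite cards1 cards2; suff -> : [set y | R1 a y] != [set y | R1 b y] by [].
by apply/eqP=> /(class_eqP r1 s1 t1); apply/negP.
Qed.

End EquivalenceClasses.

(** * Components and genus of a pair of permutations *)

Section Components.
Local Open Scope group_scope.
Variable D : finType.
Implicit Types (s t alpha : {perm D}) (a b x y z : D) (A : {set D}).

(* Unlike mulgA, rewriting with this instance leaves canonical products, which *)
(* lia identifies.                                                             *)
Lemma pmulA s t alpha : s * (t * alpha) = s * t * alpha.
Proof. exact: mulgA. Qed.

Definition linked s alpha : rel D :=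
  connect (fun x y => (y == s x) || (y == alpha x)).

Definition num_components s alpha := num_classes (linked s alpha).

Lemma linked_refl s alpha : reflexive (linked s alpha).
Proof. by move=> x; exact: connect0. Qed.

Lemma linked_trans s alpha : transitive (linked s alpha).
Proof. by move=> y x z; exact: connect_trans. Qed.

Lemma linkedl s alpha x : linked s alpha x (s x).
Proof. by apply: connect1; rewrite eqxx. Qed.

Lemma linkedr s alpha x : linked s alpha x (alpha x).
Proof. by apply: connect1; rewrite eqxx orbT. Qed.

Lemma linked_ind s alpha (R : rel D) : reflexive R -> transitive R ->
  (forall x, R x (s x)) -> (forall x, R x (alpha x)) ->
  forall x y, linked s alpha x y -> R x y.
Proof.
move=> r t Rs Ra x y /connectP[p pth ->]; elim: p x pth => //= z p IHp x.
case/andP=> xz /IHp; apply: t.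
by case/orP: xz => /eqP->.
Qed.

(** A step from x to [s x] can be undone by further steps, because x lies on the cycle of [s x]. *)
Lemma linked_sym s alpha : symmetric (linked s alpha).
Proof.
suff sub x y : linked s alpha x y -> linked s alpha y x by move=> x y;
  apply/idP/idP; exact: sub.
have back (u : {perm D}) : (forall v, linked s alpha v (u v)) ->
    forall v, linked s alpha (u v) v.
  move=> lu v; have : v \in porbit u (u v) by rewrite porbit_sym -{1}(expg1 u)
    mem_porbit.
  case/porbitP=> i {2}->; move: (u v) => w.
  elim: i => [|i IHi]; first by rewrite expg0 perm1 linked_refl.
  by rewrite expgSr permM; apply: linked_trans (lu _).
apply: (@linked_ind _ _ (fun x y => linked s alpha y x)).
- by move=> z; exact: linked_refl.
- by move=> z v w zv vw; exact: linked_trans zv.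
- by apply: back => v; exact: linkedl.
by apply: back => v; exact: linkedr.
Qed.

Lemma linked_swap s alpha : linked s alpha =2 linked alpha s.
Proof. by apply: eq_connect => x y; rewrite orbC. Qed.

Lemma linked_perm s alpha x y : linked s alpha x (s y) = linked s alpha x y.
Proof.
apply/idP/idP=> H; apply: linked_trans H _; first by rewrite linked_sym linkedl.
exact: linkedl.
Qed.

Lemma linked_porbit s alpha x y : y \in porbit (alpha * s) x -> linked s alpha x y.
Proof.
case/porbitP=> i ->; elim: i => [|i IHi]; first by rewrite expg0 perm1 linked_refl.
rewrite expgSr permM permM linked_perm; apply: linked_trans IHi _.
exact: linkedr.
Qed.

Lemma linked_fixed s alpha a x : s a = a -> alpha a = a ->
  linked s alpha a x = (x == a).
Proof.
move=> sa aa; apply/idP/eqP=> [|->]; last exact: linked_refl.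
have H : forall u v, linked s alpha u v -> (u == a) ==> (v == a).
  apply: linked_ind => [u|v u w|u|u]; first exact: implybb.
  - by move=> /implyP uv /implyP vw; apply/implyP=> /uv/vw.
  - by apply/implyP=> /eqP->; rewrite sa.
  - by apply/implyP=> /eqP->; rewrite aa.
by move/H; rewrite eqxx => /eqP.
Qed.

Lemma mem_porbit_linked s x y : (y \in porbit s x) = linked s 1 x y.
Proof.
apply/idP/idP=> [yx|]; first by apply: linked_porbit; rewrite mul1g.
apply: (@linked_ind _ _ (fun x y => y \in porbit s x)).
- by move=> u; exact: porbit_id.
- by move=> v u w; rewrite -!eq_porbit_mem => /eqP-> /eqP->.
- by move=> u; rewrite -{1}(expg1 s) mem_porbit.
by move=> u; rewrite perm1 porbit_id.
Qed.

Lemma porbit_linked s x : porbit s x = [set y | linked s 1 x y].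
Proof. by apply/setP=> y; rewrite inE mem_porbit_linked. Qed.

(* Naming this cardinal hides the syntactic variants of #|D| from lia.         *)
Definition num_points := #|D|.

Definition num_cycles s := #|porbits s|.

Lemma num_cyclesE s : num_cycles s = num_components s 1.
Proof.
rewrite /num_cycles /num_components /num_classes /porbits; congr #|pred_of_set _|.
by apply: eq_imset => x; exact: porbit_linked.
Qed.

Lemma num_cycles_le s : num_cycles s <= num_points.
Proof. by rewrite num_cyclesE num_classes_le. Qed.

(* Joining classes is a closure operation, so it suffices to compare           *)
(* generators.                                                                 *)
Lemma linked_join_eq s alpha s1 alpha1 a b :
    linked s alpha a b ->
    (forall x, linked s alpha x (s1 x)) -> (forall x, linked s alpha x (alpha1 x)) ->
    (forall R : rel D, reflexive R -> symmetric R -> transitive R -> R a b ->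
       (forall x, R x (s1 x)) -> (forall x, R x (alpha1 x)) ->
       (forall x, R x (s x)) /\ (forall x, R x (alpha x))) ->
  linked s alpha =2 join_classes (linked s1 alpha1) a b.
Proof.
set R1 := linked s1 alpha1 => ab ss1 aa1 gen x y.
have r1 : reflexive R1 by exact: linked_refl.
have s1' : symmetric R1 by exact: linked_sym.
have t1 : transitive R1 by exact: linked_trans.
have R1_le u v : R1 u v -> linked s alpha u v.
  by apply: linked_ind => //; [exact: linked_refl | exact: linked_trans].
apply/idP/or3P=> [|[/R1_le //|/andP[/R1_le xa /R1_le b_y]|/andP[/R1_le xb /R1_le ay]]].
- have [Rs Ra] : (forall x, join_classes R1 a b x (s x)) /\
                 (forall x, join_classes R1 a b x (alpha x)).
    apply: gen.
    + by move=> z; rewrite /join_classes r1.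
    + exact: join_classes_sym.
    + exact: join_classes_trans.
    + by rewrite /join_classes !r1 orbT.
    + by move=> z; rewrite /join_classes /R1 linkedl.
    by move=> z; rewrite /join_classes /R1 linkedr.
  move=> xy; apply/or3P; move: x y xy; apply: linked_ind => //.
    by move=> z; rewrite /join_classes r1.
  exact: join_classes_trans.
- by apply: linked_trans xa _; apply: linked_trans ab _.
by apply: linked_trans xb _; apply: linked_trans ay; rewrite linked_sym.
Qed.

Lemma rel_tperm (R : rel D) a b x : reflexive R -> symmetric R -> R a b ->
  R x (tperm a b x).
Proof. by move=> r s ab; case: tpermP => [->|->|_ _] //; rewrite s. Qed.

Lemma linked_tpermr s alpha a b : linked s alpha a b ->
  linked s alpha =2 join_classes (linked (s * tperm a b) alpha) a b.
Proof.
move=> ab; apply: linked_join_eq => // [x|x|R r sy t Rab Rs Ra].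
- rewrite permM; apply: linked_trans (linkedl _ _ _) _.
  by apply: rel_tperm => //; [exact: linked_refl | exact: linked_sym].
- exact: linkedr.
split=> // x; apply: t (Rs x) _; rewrite permM -{2}(tpermK a b (s x)).
exact: rel_tperm.
Qed.

Lemma linked_tperml s alpha a b : linked s alpha a b ->
  linked s alpha =2 join_classes (linked s (tperm a b * alpha)) a b.
Proof.
move=> ab; apply: linked_join_eq => // [x|x|R r sy t Rab Rs Ra].
- exact: linkedl.
- rewrite permM; apply: linked_trans _ (linkedr _ _ _).
  by apply: rel_tperm => //; [exact: linked_refl | exact: linked_sym].
split=> // x; have := Ra (tperm a b x); rewrite permM tpermK; apply: t.
exact: rel_tperm.
Qed.

Lemma num_components_tperml s alpha a b : linked s alpha a b ->
  num_components s (tperm a b * alpha) =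
  num_components s alpha + ~~ linked s (tperm a b * alpha) a b.
Proof.
move/linked_tperml=> e; apply: num_classes_join e.
- exact: linked_refl.
- exact: linked_sym.
exact: linked_trans.
Qed.

Lemma num_components_tpermr s alpha a b : linked s alpha a b ->
  num_components (s * tperm a b) alpha =
  num_components s alpha + ~~ linked (s * tperm a b) alpha a b.
Proof.
move/linked_tpermr=> e; apply: num_classes_join e.
- exact: linked_refl.
- exact: linked_sym.
exact: linked_trans.
Qed.

Lemma num_cycles_tperm s a b : a != b ->
  num_cycles (tperm a b * s) + (a \notin porbit s b).*2 = (num_cycles s).+1.
Proof. by move=> ab; have /= := porbits_mul_tperm s a b; rewrite ab addn1. Qed.

(** Multiplying by the transposition twice gives back s, so the two changes in the number of cycles
    cancel: one multiplication splits a cycle and the other merges two. *)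
Lemma mem_porbit_tperm s a b : a != b ->
  (a \in porbit (tperm a b * s) b) = (a \notin porbit s b).
Proof.
move=> ab; have := num_cycles_tperm s ab.
have := num_cycles_tperm (tperm a b * s) ab; rewrite tpermKg.
by do 2!case: (_ \in _) => /=; lia.
Qed.

(* Nonnegativity of the genus, by induction on the number of transpositions    *)
(* that bring alpha to the identity.                                           *)
Lemma euler_inequality s alpha :
  num_cycles s + num_cycles alpha + num_cycles (alpha * s)
    <= num_points + (num_components s alpha).*2.
Proof.
have [k] := ubnP (num_points - num_cycles alpha).
elim: k alpha => // k IHk alpha lek.
have [/eqP a1|] := boolP (alpha == 1).
  rewrite a1 mul1g -num_cyclesE -addnn.
  by have := num_cycles_le 1; lia.
have [x ax|fixed] := pickP (fun x => x != alpha x); last first.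
  case/negP; apply/eqP/permP=> x; rewrite perm1; apply/esym/eqP.
  by have := fixed x; move/negbFE.
set b := alpha x in ax => _.
have := num_cycles_tperm alpha ax; have := num_cycles_tperm (alpha * s) ax.
rewrite pmulA.
have -> : x \in porbit alpha b by rewrite porbit_sym /b -{1}(expg1 alpha) mem_porbit.
have le1 := num_cycles_le (tperm x b * alpha).
have := IHk (tperm x b * alpha) => IH E1 E2.
rewrite /= addn0 in E2.
have lt : num_points - num_cycles (tperm x b * alpha) < k by lia.
have {}IH := IH lt.
have := num_components_tperml (linkedr s alpha x); rewrite -/b.
(* The new transposition adds a cycle to alpha. If it merges two cycles of [alpha * s], then x and b
   share a cycle of the new product, so no component is lost; if it splits one, a possible new
   component, counted twice, compensates. *)
have : (x \notin porbit (alpha * s) b) -> linked s (tperm x b * alpha) x b.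
  rewrite -mem_porbit_tperm // pmulA => /linked_porbit.
  by rewrite linked_sym.
move: E1 E2 IH; case: (x \in _) => /=; case: linked => //= E1 E2 IH H E3; lia.
Qed.

(* By euler_inequality this means equality, i.e., that the genus is zero.      *)
Definition planar s alpha :=
  num_points + (num_components s alpha).*2
    <= num_cycles s + num_cycles alpha + num_cycles (alpha * s).

(** The left factor acts first: a becomes a fixed point and its predecessor on the cycle is sent to
    [s a], so that a is bypassed. *)
Definition detach a s := s * tperm a (s a).

Section Detach.
Variables (a : D) (s : {perm D}).

Lemma detach_id : detach a s a = a.
Proof. by rewrite permM tpermR. Qed.

Lemma detach_fixed b : s b = b -> detach a s b = b.
Proof.
move=> sb; rewrite permM sb; case: tpermP => // [ba|bsa]; first by rewrite -ba.
by apply: (@perm_inj _ s); rewrite sb.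
Qed.

Lemma detachE x : x != a -> detach a s x = if s x == a then s a else s x.
Proof.
move=> xa; rewrite permM; case: tpermP => [->|/perm_inj E|/eqP/negPf-> //].
  by rewrite eqxx.
by rewrite E eqxx in xa.
Qed.

Lemma detachK : detach a s * tperm a (s a) = s.
Proof. by rewrite -pmulA tperm2 mulg1. Qed.

Lemma detach_mul alpha : alpha a = a -> detach a (alpha * s) = alpha * detach a s.
Proof. by move=> aa; rewrite /detach permM aa pmulA. Qed.

Lemma linked_detach alpha x y : alpha a = a -> x != a ->
  linked (detach a s) alpha x y = linked s alpha x y && (y != a).
Proof.
move=> aa xa; rewrite (linked_tpermr (linkedl s alpha a)) /join_classes.
have fx z := linked_fixed z detach_id aa.
have fx' z : linked (detach a s) alpha z a = (z == a) by rewrite linked_sym fx.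
rewrite -/(detach a s) fx' (negPf xa) /= fx.
case: eqP => [->|_]; last by rewrite andbF orbF andbT.
by rewrite andbF fx' (negPf xa).
Qed.

Lemma porbit_detach x : x != a -> porbit (detach a s) x = porbit s x :\ a.
Proof.
move=> xa; apply/setP=> y; rewrite !inE !mem_porbit_linked.
by rewrite linked_detach ?perm1 // andbC.
Qed.

Lemma num_components_detach alpha : alpha a = a -> s a != a ->
  num_components (detach a s) alpha = (num_components s alpha).+1.
Proof.
move=> aa saa; rewrite num_components_tpermr ?linkedl // -/(detach a s).
by rewrite linked_fixed ?detach_id // saa addn1.
Qed.

Lemma num_cycles_detach : s a != a -> num_cycles (detach a s) = (num_cycles s).+1.
Proof. by move=> saa; rewrite !num_cyclesE num_components_detach ?perm1. Qed.

End Detach.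

(** Detaching adds one cycle to s, one to [alpha * s] and one component, so both sides of the
    inequality grow by two. *)
Lemma planar_detach a s alpha : alpha a = a -> s a != a ->
  planar (detach a s) alpha = planar s alpha.
Proof.
move=> aa sa; rewrite /planar -detach_mul // !num_cycles_detach ?permM ?aa //.
by rewrite num_components_detach //; apply/idP/idP; lia.
Qed.

(** * Cutting an edge and merging two cycles *)

Section Cut.
Variables (s alpha : {perm D}) (a b : D).
Hypotheses (ab : a != b) (alphaa : alpha a = b).

Lemma cut_counts :
  [/\ num_cycles (tperm a b * alpha) = (num_cycles alpha).+1,
      num_cycles (tperm a b * (alpha * s)) + (b \notin porbit (alpha * s) a).*2
        = (num_cycles (alpha * s)).+1
    & num_components s (tperm a b * alpha) =
      num_components s alpha + ~~ linked s (tperm a b * alpha) a b].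
Proof.
split.
- have := num_cycles_tperm alpha ab.
  suff -> : a \in porbit alpha b by rewrite addn0.
  by rewrite porbit_sym -alphaa -{1}(expg1 alpha) mem_porbit.
- by have := num_cycles_tperm (alpha * s) ab; rewrite porbit_sym.
by apply: num_components_tperml; rewrite -alphaa linkedr.
Qed.

(** The second conclusion plays the part of the Jordan curve theorem. If a and b lie on one face,
    the cut adds a cycle both to alpha and to the face permutation, and [euler_inequality] leaves
    room for them only if the component breaks in two. *)
Lemma planar_cut : planar s alpha ->
  planar s (tperm a b * alpha) /\
  linked s (tperm a b * alpha) a b = (b \notin porbit (alpha * s) a).
Proof.
case: cut_counts; rewrite /planar -pmulA => c1 c2 c3 pl.
have := euler_inequality s (tperm a b * alpha); rewrite -pmulA.
have : b \notin porbit (alpha * s) a -> linked s (tperm a b * alpha) a b.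
  rewrite porbit_sym -mem_porbit_tperm // pmulA => /linked_porbit.
  by rewrite linked_sym.
case: (b \in porbit (alpha * s) a) c2 => /=; case: linked c3 => //= c3 c2 H le;
  by split=> //; lia.
Qed.

(** The second hypothesis excludes joining two different faces of one component, which would add a
    handle. *)
Lemma planar_join : planar s (tperm a b * alpha) ->
  linked s (tperm a b * alpha) a b = (b \notin porbit (alpha * s) a) ->
  planar s alpha.
Proof.
case: cut_counts; rewrite /planar -pmulA => c1 c2 c3 pl e.
by move: c3 c2; rewrite e; case: (_ \in _) => /= c3 c2; lia.
Qed.

End Cut.

Section Merge.
Variables (s : {perm D}) (a b : D).
Hypothesis nab : b \notin porbit s a.

Lemma mem_porbit_merge x y : (y \in porbit (tperm a b * s) x) =
  [|| y \in porbit s x, (a \in porbit s x) && (y \in porbit s b)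
    | (b \in porbit s x) && (y \in porbit s a)].
Proof.
have ab : a != b by apply: contra nab => /eqP<-; exact: porbit_id.
have eqs (t : {perm D}) z w : (z \in porbit t w) = linked 1 t w z.
  by rewrite mem_porbit_linked linked_swap.
rewrite eqs (@linked_tperml _ _ a b); last first.
  by rewrite -eqs porbit_sym mem_porbit_tperm // porbit_sym.
by rewrite tpermKg /join_classes -!eqs.
Qed.

Lemma porbit_mergel : porbit (tperm a b * s) a = porbit s a :|: porbit s b.
Proof.
apply/setP=> y; rewrite mem_porbit_merge porbit_id (negPf nab) !inE /=.
by rewrite orbF.
Qed.

Lemma porbit_merge_out x : x \notin porbit (tperm a b * s) a ->
  porbit (tperm a b * s) x = porbit s x.
Proof.
rewrite porbit_mergel inE negb_or (porbit_sym _ x a) (porbit_sym _ x b).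
by case/andP=> /negPf xa /negPf xb; apply/setP=> y;
  rewrite mem_porbit_merge xa xb !orbF.
Qed.

Lemma card_porbit_merge :
  #|porbit (tperm a b * s) a| = (#|porbit s a| + #|porbit s b|)%N.
Proof.
rewrite porbit_mergel cardsU; suff -> : porbit s a :&: porbit s b = set0.
  by rewrite cards0 subn0.
apply/setP=> z; rewrite !inE; apply/negP=> /andP[za zb]; case/negP: nab.
by rewrite -eq_porbit_mem in za; rewrite -(eqP za) porbit_sym.
Qed.

End Merge.

End Components.

(** * Deletion of the root edge *)

Section StubMaps.
Local Open Scope group_scope.
Variable D : finType.
Implicit Types (s t alpha phi : {perm D}) (a b r x y z : D) (A : {set D}) (p : nat).

Definition matching A r alpha :=
  [&& perm_on A alpha, r \in A, [forall x, alpha (alpha x) == x] &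
      [forall x in A, (alpha x == x) == (x == r)]].

Definition spanning A r s alpha := [forall x in A, linked s alpha r x].

Definition face_degrees A r p phi :=
  (#|porbit phi r| == p.+1) &&
  [forall x in A, (x \notin porbit phi r) ==> (#|porbit phi x| == 3)].

(* A planar map on the darts of A, all of whose inner faces have degree 3,     *)
(* rooted at a stub r: a dart without opposite, which marks a corner of the    *)
(* outer face. The outer face has degree p, not counting the stub; the map     *)
(* with one vertex and no edge is represented by its stub alone.               *)
Definition stub_map A r p s alpha :=
  [&& perm_on A s, matching A r alpha, spanning A r s alpha, planar s alpha &
      face_degrees A r p (alpha * s)].

Lemma matchingP A r alpha :
  reflect [/\ perm_on A alpha, r \in A, forall x, alpha (alpha x) = x &
              {in A, forall x, (alpha x == x) = (x == r)}]
          (matching A r alpha).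
Proof.
apply: (iffP and4P) => [[pA rA /forallP inv /forall_inP fix1]|[pA rA inv fix1]].
  split=> // x => [|xA]; first exact/eqP/inv.
  by exact: eqP (fix1 x xA).
by split=> //; [apply/forallP=> x; rewrite inv | apply/forall_inP=> x /fix1->].
Qed.

Lemma face_degreesP A r p phi :
  reflect (#|porbit phi r| = p.+1 /\
           {in A, forall x, x \notin porbit phi r -> #|porbit phi x| = 3})
          (face_degrees A r p phi).
Proof.
apply: (iffP andP) => [[/eqP or /forall_inP o3]|[or o3]].
  by split=> // x xA xr; apply/eqP; move/implyP: (o3 x xA); apply.
split; first exact/eqP.
by apply/forall_inP=> x xA; apply/implyP=> xr; apply/eqP/o3.
Qed.

Lemma porbit_apply phi x : porbit phi (phi x) = porbit phi x.
Proof. by rewrite -{2}(expg1 phi) porbit_perm. Qed.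

Section Edge.
Variables (s alpha : {perm D}) (A : {set D}) (r a b : D).
Hypotheses (ra : r != a) (rb : r != b) (ab : a != b).
Hypotheses (sr : s r = a) (alphar : alpha r = r).
Hypotheses (alphaa : alpha a = b) (alphab : alpha b = a).

Let phi := alpha * s.
Let alpha0 := tperm a b * alpha.
Let psi := tperm a b * phi.

Lemma cut_fixl : alpha0 a = a. Proof. by rewrite permM tpermL. Qed.

Lemma cut_fixr : alpha0 b = b. Proof. by rewrite permM tpermR. Qed.

Lemma root_next : phi r = a. Proof. by rewrite permM alphar. Qed.

Lemma cut_root_next : psi r = a.
Proof. by rewrite permM tpermD 1?eq_sym // root_next. Qed.

Lemma root_moved : s a != a.
Proof. by rewrite -{2}sr (inj_eq perm_inj) eq_sym. Qed.

Lemma detach_cut : detach a psi = alpha0 * detach a s.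
Proof. by rewrite -detach_mul ?cut_fixl // /psi /phi pmulA. Qed.

Section Triangle.
Hypotheses (nab : b \notin porbit phi a) (b3 : #|porbit phi b| = 3).
Hypotheses (rA : r \in A).
Let s2 := detach b (detach a s).
Let A2 := A :\ a :\ b.

Lemma tri_moved : detach a s b != b.
Proof.
have sb : s b != b.
  apply: contra nab => /eqP sb; rewrite -(porbit_apply phi a).
  by rewrite {2}/phi permM alphaa sb porbit_id.
have ba : b != a by rewrite eq_sym.
rewrite detachE //; case: (s b =P a) => [sba|//].
have /perm_inj br : s b = s r by rewrite sba sr.
by move: rb; rewrite br eqxx.
Qed.

(** The edge separates two faces, so a and b lie on one face after the cut and remain linked:
    cutting changes no component. *)
Lemma tri_linked x : linked s2 alpha0 r x = [&& linked s alpha r x, x != a & x != b].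
Proof.
rewrite linked_detach ?cut_fixr // linked_detach ?cut_fixl // -andbA.
congr (_ && _); have lab : linked s alpha a b by rewrite -alphaa linkedr.
rewrite (linked_tperml lab) -/alpha0 /join_classes.
have l0 : linked s alpha0 a b.
  apply: linked_porbit; rewrite /alpha0 -pmulA porbit_sym mem_porbit_tperm //.
  by rewrite porbit_sym.
apply/idP/or3P=> [|[//|/andP[xa xb]|/andP[xb xa]]]; first by constructor.
  by apply: linked_trans xa _; apply: linked_trans l0 _.
by apply: linked_trans xb _; apply: linked_trans xa; rewrite linked_sym.
Qed.

Lemma tri_planar : planar s2 alpha0 = planar s alpha.
Proof.
rewrite planar_detach ?cut_fixr ?tri_moved // planar_detach ?cut_fixl ?root_moved //.
have l0 : linked s alpha0 a b = (b \notin porbit phi a).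
  rewrite nab; apply: linked_porbit; rewrite /alpha0 -pmulA porbit_sym.
  by rewrite mem_porbit_tperm // porbit_sym.
apply/idP/idP=> [pl|pl]; first exact: (planar_join ab alphaa pl).
by have [] := planar_cut ab alphaa pl.
Qed.

Lemma tri_spanning : spanning A2 r s2 alpha0 = spanning A r s alpha.
Proof.
apply/forall_inP/forall_inP=> lA x.
  move=> xA; have la : linked s alpha r a by rewrite -sr linkedl.
  have [->//|xa] := eqVneq x a.
  have [->|xb] := eqVneq x b.
    by apply: linked_trans la _; rewrite -alphaa linkedr.
  by have := lA x; rewrite !inE xa xb => /(_ xA); rewrite tri_linked => /andP[].
by rewrite !inE => /and3P[xb xa xA]; rewrite tri_linked xa xb lA.
Qed.

(** The outer orbit, with p + 1 darts including the stub, absorbs the three darts of the triangle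
    and loses a and b, which leaves p + 2. Being an equality, the lemma serves both for removing and
    for adding an edge. *)
Lemma tri_faces p :
  face_degrees A2 r p.+1 (alpha0 * s2) = face_degrees A r p phi.
Proof.
have -> : alpha0 * s2 = detach b (detach a psi).
  by rewrite detach_cut detach_mul ?cut_fixr.
have porb x : x != a -> x != b ->
    porbit (detach b (detach a psi)) x = porbit psi x :\ a :\ b.
  by move=> xa xb; rewrite !porbit_detach.
have psia : porbit psi a = porbit psi r by rewrite -(porbit_apply psi r) cut_root_next.
have phia : porbit phi a = porbit phi r by rewrite -(porbit_apply phi r) root_next.
have cr : #|porbit psi r| = #|porbit (detach b (detach a psi)) r|.+2.
  rewrite porb // (cardsD1 a) -psia porbit_id (cardsD1 b) !inE eq_sym ab.
  by rewrite porbit_sym mem_porbit_tperm // porbit_sym nab.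
have cm : #|porbit psi r| = (#|porbit phi r| + 3)%N.
  by rewrite -psia (card_porbit_merge nab) phia b3.
have out x : x \notin porbit psi r -> [/\ x != a, x != b, porbit psi x = porbit phi x
    & porbit (detach b (detach a psi)) x = porbit phi x].
  rewrite -psia => xr; have e := porbit_merge_out nab xr.
  have xa : x != a by apply: contra xr => /eqP->; exact: porbit_id.
  have xb : x != b.
    by apply: contra xr => /eqP->; rewrite /psi porbit_mergel // inE porbit_id orbT.
  split=> //; rewrite porb // e; apply/setP=> y; rewrite !inE.
  case: eqP => [->|_]; [|case: eqP => [->|//]]; rewrite -e porbit_sym.
    apply/esym/negP=> bx; case/negP: xr; rewrite -eq_porbit_mem.
    move: bx; rewrite -eq_porbit_mem => /eqP->; rewrite eq_porbit_mem.
    by rewrite /psi porbit_mergel // inE porbit_id orbT.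
  by rewrite (negPf xr).
have in_psi x : (x \in porbit psi r) = (x \in porbit phi r) || (x \in porbit phi b).
  by rewrite -psia /psi porbit_mergel // inE phia.
apply/face_degreesP/face_degreesP=> -[cE cF]; split.
- by move: cr cm; rewrite cE => ->; lia.
- move=> x xA xr; have [xb|xb] := boolP (x \in porbit phi b).
    by move: xb; rewrite -eq_porbit_mem => /eqP->.
  have [|xa' xb' e1 e2] := out x; first by rewrite in_psi negb_or xr.
  rewrite -e2; apply: cF; first by rewrite !inE xa' xb'.
  by rewrite porb // !inE xa' xb' in_psi negb_or xr.
- by move: cr cm; rewrite cE => ->; lia.
move=> x; rewrite !inE => /and3P[xb xa xA]; rewrite porb // !inE xa xb /= => xr.
have [_ _ _ ->] := out x xr; apply: cF => //.
by apply: contra xr; rewrite in_psi => ->.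
Qed.

End Triangle.

End Edge.

End StubMaps.

(** * Permutations with disjoint supports and deletion of a bridge *)

Section DisjointSupports.
Local Open Scope group_scope.
Variable D : finType.
Implicit Types (s t alpha phi : {perm D}) (a b r x y z : D) (A : {set D}) (p : nat).

Lemma linked_on A s alpha x y : perm_on A s -> perm_on A alpha -> x \in A ->
  linked s alpha x y -> y \in A.
Proof.
move=> sA aA xA xy; suff /implyP/(_ xA) : (x \in A) ==> (y \in A) by [].
move: x y xy {xA}; apply: linked_ind => [x|y x z|x|x]; first exact: implybb.
- by move=> /implyP xy /implyP yz; apply/implyP=> /xy/yz.
- by rewrite (perm_closed x sA) implybb.
by rewrite (perm_closed x aA) implybb.
Qed.

Section ProductAction.
Variables (A1 A2 : {set D}) (s1 s2 : {perm D}).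
Hypotheses (dA : [disjoint A1 & A2]) (sA1 : perm_on A1 s1) (sA2 : perm_on A2 s2).

Lemma disjoint_mull x : x \in A1 -> (s1 * s2) x = s1 x.
Proof.
move=> xA; rewrite permM (out_perm sA2) //.
by rewrite (disjointFr dA) // perm_closed.
Qed.

Lemma disjoint_mulr x : x \notin A1 -> (s1 * s2) x = s2 x.
Proof. by move=> xA; rewrite permM (out_perm sA1). Qed.

End ProductAction.

Section ProductLinks.
Variables (A1 A2 : {set D}) (s1 s2 alpha1 alpha2 : {perm D}).
Hypothesis dA : [disjoint A1 & A2].
Hypotheses (sA1 : perm_on A1 s1) (aA1 : perm_on A1 alpha1).
Hypotheses (sA2 : perm_on A2 s2) (aA2 : perm_on A2 alpha2).

Lemma linked_mull x y : x \in A1 ->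
  linked (s1 * s2) (alpha1 * alpha2) x y = linked s1 alpha1 x y.
Proof.
have S x' : x' \in A1 -> (s1 * s2) x' = s1 x' by exact: (disjoint_mull dA).
have T x' : x' \in A1 -> (alpha1 * alpha2) x' = alpha1 x' by exact: (disjoint_mull dA).
have cl1 x' : (s1 x' \in A1) = (x' \in A1) by rewrite perm_closed.
have cl2 x' : (alpha1 x' \in A1) = (x' \in A1) by rewrite perm_closed.
have gen (L : rel D) : reflexive L -> transitive L ->
    reflexive (fun u v => (u \in A1) ==> (v \in A1) && L u v) /\
    transitive (fun u v => (u \in A1) ==> (v \in A1) && L u v).
  move=> Lr Lt; split=> [u|v u w /implyP uv /implyP vw].
    by apply/implyP=> ->; rewrite Lr.
  apply/implyP=> /uv/andP[vA Luv]; have /andP[-> Lvw] := vw vA.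
  exact: Lt Luv Lvw.
move=> xA; apply/idP/idP=> xy.
  suff /implyP/(_ xA)/andP[] : (x \in A1) ==> (y \in A1) && linked s1 alpha1 x y by [].
  have [r t] := gen _ (@linked_refl _ s1 alpha1) (@linked_trans _ s1 alpha1).
  move: x y xy {xA}; apply: linked_ind => // x; apply/implyP=> xA.
    by rewrite S // cl1 xA linkedl.
  by rewrite T // cl2 xA linkedr.
suff /implyP/(_ xA)/andP[] :
  (x \in A1) ==> (y \in A1) && linked (s1 * s2) (alpha1 * alpha2) x y by [].
have [r t] := gen _ (@linked_refl _ (s1 * s2) (alpha1 * alpha2))
                    (@linked_trans _ (s1 * s2) (alpha1 * alpha2)).
move: x y xy {xA}; apply: linked_ind => // x; apply/implyP=> xA.
  by rewrite cl1 xA -(S x xA) linkedl.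
by rewrite cl2 xA -(T x xA) linkedr.
Qed.

End ProductLinks.

Section ProductComponents.
Variables (A1 A2 : {set D}) (s1 s2 alpha1 alpha2 : {perm D}).
Hypothesis dA : [disjoint A1 & A2].
Hypotheses (sA1 : perm_on A1 s1) (aA1 : perm_on A1 alpha1).
Hypotheses (sA2 : perm_on A2 s2) (aA2 : perm_on A2 alpha2).

Lemma linked_mulr x y : x \notin A1 ->
  linked (s1 * s2) (alpha1 * alpha2) x y = linked s2 alpha2 x y.
Proof.
move=> xA; have sub : A2 \subset ~: A1 by rewrite -disjoints_subset disjoint_sym.
have dC : [disjoint ~: A1 & A1] by rewrite disjoints_subset.
have sC : perm_on (~: A1) s2 by apply: subset_trans sA2 sub.
have aC : perm_on (~: A1) alpha2 by apply: subset_trans aA2 sub.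
rewrite (perm_onC sA1 sA2 dA) (perm_onC aA1 aA2 dA).
by rewrite (linked_mull dC) // inE.
Qed.

Lemma num_components_mul :
  num_components (s1 * s2) (alpha1 * alpha2) + num_points D =
  num_components s1 alpha1 + num_components s2 alpha2.
Proof.
have split_on s alpha : {in A1, forall x y, linked s alpha x y -> y \in A1} ->
  num_components s alpha = #|[set [set y | linked s alpha x y] | x in A1]| +
                         #|[set [set y | linked s alpha x y] | x in ~: A1]|.
  move=> cl; apply: (num_classes_split (@linked_refl _ s alpha) (@linked_sym _ s
    alpha) (@linked_trans _ s alpha)) => x y xy.
  apply/idP/idP=> H; first exact: cl H _ xy.
  by apply: cl H _ _; rewrite linked_sym.
have single s alpha (X : {set D}) : {in X, forall x, s x = x} ->
  {in X, forall x, alpha x = x} ->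
    #|[set [set y | linked s alpha x y] | x in X]| = #|X|.
  move=> sX aX; rewrite -(card_imset X (@set1_inj D)); congr #|pred_of_set _|.
  apply: eq_in_imset => x xX; apply/setP=> y; rewrite !inE.
  by rewrite linked_fixed ?sX ?aX.
rewrite !split_on.
- rewrite (single s1 alpha1 (~: A1)); first last.
    by move=> x; rewrite inE; exact: out_perm.
    by move=> x; rewrite inE; exact: out_perm.
  rewrite (single s2 alpha2 A1); first last.
    by move=> x xA; apply: (out_perm aA2); rewrite (disjointFr dA xA).
    by move=> x xA; apply: (out_perm sA2); rewrite (disjointFr dA xA).
  have -> : [set [set y | linked (s1 * s2) (alpha1 * alpha2) x y] | x in A1] =
            [set [set y | linked s1 alpha1 x y] | x in A1].
    by apply: eq_in_imset => x xA; apply/setP=> y; rewrite !inE (linked_mull dA).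
  have -> : [set [set y | linked (s1 * s2) (alpha1 * alpha2) x y] | x in ~: A1] =
            [set [set y | linked s2 alpha2 x y] | x in ~: A1].
    apply: eq_in_imset => x; rewrite inE => xA; apply/setP=> y.
    by rewrite !inE linked_mulr.
  by rewrite /num_points -(cardsC A1); lia.
- move=> x xA y; rewrite linked_fixed; first by move/eqP->.
    by apply: (out_perm sA2); rewrite (disjointFr dA xA).
  by apply: (out_perm aA2); rewrite (disjointFr dA xA).
- by move=> x xA y; exact: linked_on.
by move=> x xA y; rewrite (linked_mull dA) //; exact: linked_on.
Qed.

End ProductComponents.

Section ProductCycles.
Variables (A1 A2 : {set D}) (s1 s2 alpha1 alpha2 : {perm D}).
Hypothesis dA : [disjoint A1 & A2].
Hypotheses (sA1 : perm_on A1 s1) (aA1 : perm_on A1 alpha1).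
Hypotheses (sA2 : perm_on A2 s2) (aA2 : perm_on A2 alpha2).

Lemma num_cycles_mul : num_cycles (s1 * s2) + num_points D =
  num_cycles s1 + num_cycles s2.
Proof.
rewrite !num_cyclesE -{1}(mulg1 1).
by apply: (num_components_mul dA); rewrite ?perm_on1.
Qed.

Lemma face_mul : (alpha1 * alpha2) * (s1 * s2) = (alpha1 * s1) * (alpha2 * s2).
Proof.
rewrite -!pmulA; congr (_ * _); rewrite !pmulA; congr (_ * _).
by rewrite (perm_onC sA1 aA2 dA).
Qed.

End ProductCycles.

(** The genus is additive over disjoint supports, and neither summand is negative by
    [euler_inequality], so the sum vanishes only if both do. *)
Lemma planar_mul A1 A2 s1 s2 alpha1 alpha2 : [disjoint A1 & A2] ->
  perm_on A1 s1 -> perm_on A1 alpha1 -> perm_on A2 s2 -> perm_on A2 alpha2 ->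
  planar (s1 * s2) (alpha1 * alpha2) = planar s1 alpha1 && planar s2 alpha2.
Proof.
move=> dA sA1 aA1 sA2 aA2; rewrite /planar (face_mul _ _ dA sA1 aA2).
have := num_cycles_mul dA sA1 sA2; have := num_cycles_mul dA aA1 aA2.
have := num_cycles_mul dA (perm_onM aA1 sA1) (perm_onM aA2 sA2).
have := num_components_mul dA sA1 aA1 sA2 aA2.
have := euler_inequality s1 alpha1; have := euler_inequality s2 alpha2.
by move=> *; apply/idP/andP=> [H|[]]; [split|]; lia.
Qed.

Lemma porbit_mul A1 A2 phi1 phi2 x : [disjoint A1 & A2] ->
  perm_on A1 phi1 -> perm_on A2 phi2 ->
  porbit (phi1 * phi2) x = if x \in A1 then porbit phi1 x else porbit phi2 x.
Proof.
move=> dA p1 p2; case: ifPn => xA; apply/setP=> y;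
  rewrite !mem_porbit_linked -{1}(mulg1 1).
  by rewrite (linked_mull dA) ?perm_on1.
by rewrite (linked_mulr dA) ?perm_on1.
Qed.

Lemma porbit_on A phi x : perm_on A phi -> x \in A -> porbit phi x \subset A.
Proof.
move=> pA xA; apply/subsetP=> y; rewrite mem_porbit_linked.
by apply: linked_on; rewrite ?perm_on1.
Qed.

Section Bridge.
Variables (s alpha s1 s2 alpha1 alpha2 : {perm D}) (A A1 A2 : {set D}) (r a b : D).
Hypotheses (ra : r != a) (rb : r != b) (ab : a != b).
Hypotheses (sr : s r = a) (alphar : alpha r = r).
Hypotheses (alphaa : alpha a = b) (alphab : alpha b = a).
Hypotheses (dA : [disjoint A1 & A2]) (rA1 : r \in A1) (bA2 : b \in A2).
Hypothesis (aA : a \notin A1 :|: A2).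
Hypothesis (defA : A = a |: (A1 :|: A2)).
Hypotheses (sA1 : perm_on A1 s1) (aA1 : perm_on A1 alpha1).
Hypotheses (sA2 : perm_on A2 s2) (aA2 : perm_on A2 alpha2).
Hypothesis (def_s : detach a s = s1 * s2).
Hypothesis (def_alpha : tperm a b * alpha = alpha1 * alpha2).

Let phi := alpha * s.
Let phi1 := alpha1 * s1.
Let phi2 := alpha2 * s2.
Let psi := tperm a b * phi.

Hypothesis bphi : b \in porbit phi a.

Lemma bridge_pieces_disjoint x : x \in A1 -> x \in A2 -> False.
Proof. by move=> x1; rewrite (disjointFr dA x1). Qed.

Lemma bridge_linked z v : z != a ->
  linked (s1 * s2) (alpha1 * alpha2) z v =
  linked s (tperm a b * alpha) z v && (v != a).
Proof.
by move=> za; rewrite -def_s -def_alpha linked_detach // (cut_fixl alphab).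
Qed.

Lemma bridge_linked_root x : x != a -> linked s (tperm a b * alpha) r x =
  linked s1 alpha1 r x.
Proof.
move=> xa; have := bridge_linked x ra; rewrite xa andbT => <-.
by rewrite (linked_mull dA).
Qed.

Lemma bridge_linked_end x : x != a -> linked s (tperm a b * alpha) b x =
  linked s2 alpha2 b x.
Proof.
move=> xa; have ba : b != a by rewrite eq_sym.
have := bridge_linked x ba; rewrite xa andbT => <-.
by rewrite (linked_mulr dA) //; apply/negP=> b1; exact: bridge_pieces_disjoint bA2.
Qed.

Lemma bridge_unlinked : linked s (tperm a b * alpha) r b = false.
Proof.
rewrite bridge_linked_root; last by rewrite eq_sym.
apply/negP=> /(linked_on sA1 aA1 rA1) b1; exact: bridge_pieces_disjoint bA2.
Qed.

(** After the cut, a lies in the component of r and b in the other one; this is the case of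
    [planar_join] where the edge has one face on both sides. *)
Lemma bridge_planar : planar s alpha = planar s1 alpha1 && planar s2 alpha2.
Proof.
rewrite -(planar_mul dA) // -def_s -def_alpha.
rewrite planar_detach ?(cut_fixl alphab) //; last exact: (root_moved ra sr).
apply/idP/idP=> [pl|pl]; first by have [] := planar_cut ab alphaa pl.
apply: (planar_join ab alphaa pl); rewrite bphi; apply/negP=> lab.
move: bridge_unlinked; rewrite (linked_trans _ lab) //.
by rewrite -sr linkedl.
Qed.

Lemma bridge_spanning :
  spanning A r s alpha = spanning A1 r s1 alpha1 && spanning A2 b s2 alpha2.
Proof.
have lab : linked s alpha a b by rewrite -alphaa linkedr.
have lra : linked s alpha r a by rewrite -sr linkedl.
have a1 x : x \in A1 -> x != a.
  by move=> xA; apply: contraNneq aA => <-; rewrite inE xA.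
have a2 x : x \in A2 -> x != a.
  by move=> xA; apply: contraNneq aA => <-; rewrite inE xA orbT.
apply/forall_inP/andP=> [lA|[/forall_inP l1 /forall_inP l2] x].
  have lA' x : x \in A -> linked s (tperm a b * alpha) r x || linked s (tperm a b *
    alpha) b x.
    move=> /lA; rewrite (linked_tperml lab) /join_classes bridge_unlinked orbF.
    by case/orP=> [->//|/andP[_ ->]]; rewrite orbT.
  split; apply/forall_inP=> x xA.
    have /lA' : x \in A by rewrite defA !inE xA orbT.
    rewrite bridge_linked_root ?a1 // bridge_linked_end ?a1 //.
    by case/orP=> // /(linked_on sA2 aA2 bA2) /(bridge_pieces_disjoint xA).
  have /lA' : x \in A by rewrite defA !inE xA !orbT.
  rewrite bridge_linked_root ?a2 // bridge_linked_end ?a2 //.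
  by case/orP=> // /(linked_on sA1 aA1 rA1) /bridge_pieces_disjoint /(_ xA).
rewrite defA !inE => /or3P[/eqP->//|xA|xA].
  by rewrite (linked_tperml lab) /join_classes bridge_linked_root ?a1 ?l1.
apply: (linked_trans lra); apply: (linked_trans lab).
by rewrite (linked_tperml lab) /join_classes bridge_linked_end ?a2 ?l2.
Qed.

Lemma bridge_porbit x : x != a -> porbit psi x :\ a =
  if x \in A1 then porbit phi1 x else porbit phi2 x.
Proof.
move=> xa; rewrite -porbit_detach // (detach_cut _ alphab) def_alpha def_s.
by rewrite (face_mul _ _ dA sA1 aA2) (porbit_mul _ dA) ?perm_onM.
Qed.

(** Cutting the bridge splits the outer orbit into two: that of r, which is the outer orbit of the
    first map with a inserted, and that of b, which is the outer orbit of the second map. *)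
Lemma bridge_face : #|porbit phi r| = (#|porbit phi1 r| + #|porbit phi2 b|).+1 /\
  porbit phi r = a |: (porbit phi1 r :|: porbit phi2 b).
Proof.
have nab : b \notin porbit psi a.
  by rewrite porbit_sym mem_porbit_tperm // negbK porbit_sym.
have phiE : phi = tperm a b * psi by rewrite /psi pmulA tperm2 mul1g.
have phir : porbit phi r = porbit phi a.
  by rewrite -(porbit_apply phi r) (root_next sr alphar).
have psir : porbit psi r = porbit psi a.
  by rewrite -(porbit_apply psi r) (cut_root_next ra rb sr alphar).
have e1 : porbit psi r = a |: porbit phi1 r.
  have := bridge_porbit ra; rewrite rA1 => <-; rewrite setD1K // psir; exact: porbit_id.
have ba : b != a by rewrite eq_sym.
have e2 : porbit psi b = porbit phi2 b.
  have := bridge_porbit ba; rewrite ifN; last first.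
    by apply/negP=> b1; exact: bridge_pieces_disjoint bA2.
  move=> <-; apply/setP=> y; rewrite !inE; case: eqP => // ->.
  by rewrite porbit_sym (negPf nab).
split.
  rewrite phir phiE (card_porbit_merge nab) -psir e1 e2 cardsU1.
  suff -> : a \notin porbit phi1 r by rewrite add1n.
  apply: contra aA => /(subsetP (porbit_on (perm_onM aA1 sA1) rA1)).
  by rewrite inE => ->.
by rewrite phir phiE (porbit_mergel nab) -psir e1 e2 setUA.
Qed.

Lemma bridge_face_out x : x \in A -> x \notin porbit phi r ->
  porbit phi x = if x \in A1 then porbit phi1 x else porbit phi2 x.
Proof.
have nab : b \notin porbit psi a.
  by rewrite porbit_sym mem_porbit_tperm // negbK porbit_sym.
have phiE : phi = tperm a b * psi by rewrite /psi pmulA tperm2 mul1g.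
have phir : porbit phi r = porbit phi a.
  by rewrite -(porbit_apply phi r) (root_next sr alphar).
rewrite phir => xA xr; have xa : x != a.
  by apply: contraNneq xr => ->; exact: porbit_id.
rewrite -bridge_porbit // {1}phiE porbit_merge_out -?phiE //.
apply/setP=> y; rewrite !inE; case: eqP => //= ->.
apply/negbTE; apply: contra xr; rewrite porbit_sym => ax.
by rewrite phiE porbit_mergel // inE ax.
Qed.

(** With the stubs r and b counted, the orbit sizes satisfy p + 1 = (p1 + 1) + (p2 + 1) + 1, the
    last unit being a. *)
Lemma bridge_faces p :
  face_degrees A r p phi <->
  exists p1 p2, [/\ p = (p1 + p2).+2, face_degrees A1 r p1 phi1 & face_degrees A2 b
    p2 phi2].
Proof.
have [cr er] := bridge_face.
have sub1 := subsetP (porbit_on (perm_onM aA1 sA1) rA1).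
have sub2 := subsetP (porbit_on (perm_onM aA2 sA2) bA2).
have neq1 x : x \in A1 -> (x \in porbit phi r) = (x \in porbit phi1 r).
  move=> xA; rewrite er !inE; case: eqP => [xa|_].
    by case/negP: aA; rewrite -xa inE xA.
  by case: (boolP (x \in porbit phi2 b)) => [/sub2/(bridge_pieces_disjoint xA)|];
    rewrite ?orbF.
have neq2 x : x \in A2 -> (x \in porbit phi r) = (x \in porbit phi2 b).
  move=> xA; rewrite er !inE; case: eqP => [xa|_].
    by case/negP: aA; rewrite -xa inE xA orbT.
  by case: (boolP (x \in porbit phi1 r)) => [/sub1/bridge_pieces_disjoint/(_ xA)|].
have inA1 x : x \in A1 -> x \in A by move=> xA; rewrite defA !inE xA orbT.
have inA2 x : x \in A2 -> x \in A by move=> xA; rewrite defA !inE xA !orbT.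
have nA1 x : x \in A2 -> x \in A1 = false by move=> xA;
  apply/negP=> /bridge_pieces_disjoint/(_ xA).
split=> [/face_degreesP[c3 f3]|[p1] [p2] [pE /face_degreesP[c1 f1]
  /face_degreesP[c2 f2]]].
  have o1 : 0 < #|porbit phi1 r| by rewrite lt0n card_porbit_neq0.
  have o2 : 0 < #|porbit phi2 b| by rewrite lt0n card_porbit_neq0.
  exists #|porbit phi1 r|.-1, #|porbit phi2 b|.-1; split.
  - move: c3 o1 o2; rewrite cr.
    case: #|porbit phi1 r| => // n1; case: #|porbit phi2 b| => // n2 [<-] _ _.
    by rewrite addSn addnS /=.
  - apply/face_degreesP; split=> [|x xA xr]; first by rewrite prednK.
    have := bridge_face_out (inA1 x xA); rewrite neq1 // xA => /(_ xr) <-.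
    by apply: f3; rewrite ?inA1 // neq1.
  apply/face_degreesP; split=> [|x xA xr]; first by rewrite prednK.
  have := bridge_face_out (inA2 x xA); rewrite neq2 // nA1 // => /(_ xr) <-.
  by apply: f3; rewrite ?inA2 // neq2.
apply/face_degreesP; split=> [|x xA xr]; first by rewrite cr c1 c2 pE addSn addnS.
rewrite bridge_face_out //; move: (xA); rewrite {1}defA !inE => /or3P[/eqP xa|x1|x2].
- by case/negP: xr; rewrite er xa !inE eqxx.
- by rewrite x1 f1 // -neq1.
by rewrite nA1 // f2 // -neq2.
Qed.

End Bridge.

End DisjointSupports.

(** * Stub maps whose root edge borders a triangle *)

Section Fibres.
Local Open Scope group_scope.
Variable D : finType.
Implicit Types (s t alpha phi : {perm D}) (a b r x y z : D) (A : {set D}) (p : nat).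

Definition stub_maps A r p : {set {perm D} * {perm D}} :=
  [set S | stub_map A r p S.1 S.2].

Lemma perm_on_tperm A x y : x \in A -> y \in A -> perm_on A (tperm x y).
Proof.
move=> xA yA; apply: subset_trans (tperm_on x y) _.
by apply/subsetP=> z; rewrite !inE => /orP[] /eqP->.
Qed.

Lemma perm_on_detach A a s : perm_on A s -> perm_on (A :\ a) (detach a s).
Proof.
move=> sA; apply/subsetP=> x; rewrite inE => xm; rewrite !inE.
apply/andP; split; first by apply: contraNneq xm => ->; rewrite detach_id.
by apply: contraR xm => xA; rewrite detach_fixed // (out_perm sA).
Qed.

Lemma tperm_disjointC a b x y : a != b -> a != y -> x != b -> x != y ->
  tperm a x * tperm b y = tperm b y * tperm a x.
Proof.
move=> ab ay xb xy; have := tpermJ a x (tperm b y).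
rewrite !(@tpermD _ b y) 1?eq_sym // => /(congr1 (mulg (tperm b y))).
by rewrite -conjgC => ->.
Qed.

Lemma porbit3P phi x : phi (phi (phi x)) = x -> phi x != x ->
  #|porbit phi x| = 3 /\ porbit phi x = [set x; phi x; phi (phi x)].
Proof.
move=> p3 px; have e : porbit phi x = [set x; phi x; phi (phi x)].
  apply/setP=> y; rewrite !inE; apply/idP/idP=> [/porbitP[i ->]|].
    elim: i => [|i]; first by rewrite expg0 perm1 eqxx.
    rewrite expgSr permM => /orP[/orP[]|] /eqP->; rewrite ?eqxx ?orbT //.
    by rewrite p3 eqxx.
  by case/orP=> [/orP[]|] /eqP->; rewrite -eq_porbit_mem ?porbit_apply.
have p2x : phi (phi x) != x by apply: contra px => /eqP p2; rewrite -{2}p3 p2.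
split=> //; rewrite e -setUA cardsU1 cards2 !inE negb_or.
by rewrite (eq_sym x (phi x)) px (eq_sym x (phi (phi x))) p2x (inj_eq perm_inj)
  eq_sym px.
Qed.

Lemma card_porbit_gt phi x : 2 < #|porbit phi x| ->
  [/\ phi x != x, phi (phi x) != x & phi (phi x) != phi x].
Proof.
have := uniq_traject_porbit phi x; case: #|porbit phi x| => [|[|[|n]]] //=.
by rewrite !inE !negb_or (eq_sym x) (eq_sym x) => /and4P[/and3P[-> ->
  _] /andP[e _] _ _ _];
  rewrite eq_sym e.
Qed.

Lemma porbit3_cycle phi x : #|porbit phi x| = 3 -> phi (phi (phi x)) = x.
Proof. by move=> e; have := iter_porbit phi x; rewrite e. Qed.

Section Fibre.
Variables (A : {set D}) (r a b : D) (p : nat).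
Hypotheses (rA : r \in A) (aA : a \in A :\ r) (bA : b \in A :\ r :\ a).

Let fibre := [set S in stub_maps A r p | (S.1 r == a) && (S.2 a == b)].

Let ra : r != a. Proof. by move: aA; rewrite !inE eq_sym => /andP[]. Qed.
Let rb : r != b. Proof. by move: bA; rewrite !inE (eq_sym r) => /and3P[]. Qed.
Let ab : a != b. Proof. by move: bA; rewrite !inE (eq_sym a) => /and3P[]. Qed.
Let ba : b != a. Proof. by rewrite eq_sym. Qed.
Let aA' : a \in A. Proof. by move: aA; rewrite !inE => /andP[]. Qed.
Let bA' : b \in A. Proof. by move: bA; rewrite !inE => /and3P[]. Qed.

(* The triangle cut off by the new edge consists of b and of the two darts     *)
(* that follow the stub on the outer face: a is inserted in the corner after   *)
(* the stub and b in the corner two edges further.                             *)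
Definition add_triangle (S : {perm D} * {perm D}) :=
  let phi := S.2 * S.1 in
  (S.1 * tperm a (phi r) * tperm b (phi (phi (phi r))), tperm a b * S.2).

Definition remove_edge (S : {perm D} * {perm D}) :=
  (detach b (detach a S.1), tperm a b * S.2).

Lemma fibreP S : S \in fibre -> [/\ stub_map A r p S.1 S.2, S.1 r = a, S.2 a = b,
  S.2 b = a & S.2 r = r].
Proof.
rewrite !inE => /and3P[v /eqP e1 /eqP e2]; split=> //.
  by case/and5P: v => _ /matchingP[_ _ inv _] _ _ _; rewrite -e2 inv.
by case/and5P: v => _ /matchingP[_ _ _ fx] _ _ _; apply/eqP; rewrite fx.
Qed.

Lemma cut_matching alpha : matching A r alpha -> alpha a = b ->
  [/\ perm_on (A :\ a :\ b) (tperm a b * alpha),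
      forall x, (tperm a b * alpha) ((tperm a b * alpha) x) = x &
      {in A :\ a :\ b, forall x, ((tperm a b * alpha) x == x) = (x == r)}].
Proof.
case/matchingP=> aOn _ inv fx ea; have eb : alpha b = a by rewrite -ea inv.
have e0 x : x != a -> x != b -> (tperm a b * alpha) x = alpha x.
  by move=> xa xb; rewrite permM tpermD // eq_sym.
have ea0 : (tperm a b * alpha) a = a by rewrite permM tpermL.
have eb0 : (tperm a b * alpha) b = b by rewrite permM tpermR.
split.
- apply/subsetP=> x; rewrite !inE => xm.
  have xa : x != a by apply: contraNneq xm => ->; rewrite ea0.
  have xb : x != b by apply: contraNneq xm => ->; rewrite eb0.
  rewrite xa xb /=; apply: contraR xm => xA.
  by rewrite e0 // (out_perm aOn).
- move=> x; have [->|xa] := eqVneq x a; first by rewrite !ea0.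
  have [->|xb] := eqVneq x b; first by rewrite !eb0.
  have na : alpha x != a by rewrite -eb (inj_eq perm_inj).
  have nb : alpha x != b by rewrite -ea (inj_eq perm_inj).
  by rewrite (e0 x) // e0.
by move=> x; rewrite !inE => /and3P[xb xa xA]; rewrite e0 ?fx.
Qed.

Lemma join_matching alpha0 : perm_on (A :\ a :\ b) alpha0 ->
  (forall x, alpha0 (alpha0 x) = x) ->
  {in A :\ a :\ b, forall x, (alpha0 x == x) = (x == r)} ->
  matching A r (tperm a b * alpha0).
Proof.
move=> aOn inv fx; have e0a : alpha0 a = a by rewrite (out_perm aOn) // !inE eqxx andbF.
have e0b : alpha0 b = b by rewrite (out_perm aOn) // !inE eqxx.
have ea : (tperm a b * alpha0) a = b by rewrite permM tpermL e0b.
have eb : (tperm a b * alpha0) b = a by rewrite permM tpermR e0a.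
have e0 x : x != a -> x != b -> (tperm a b * alpha0) x = alpha0 x.
  by move=> xa xb; rewrite permM tpermD // eq_sym.
apply/matchingP; split=> //.
- apply: perm_onM; first exact: perm_on_tperm.
  apply: subset_trans aOn _; apply/subsetP=> x; by rewrite !inE => /and3P[].
- move=> x; have [->|xa] := eqVneq x a; first by rewrite ea eb.
  have [->|xb] := eqVneq x b; first by rewrite eb ea.
  have na : alpha0 x != a by rewrite -e0a (inj_eq perm_inj).
  have nb : alpha0 x != b by rewrite -e0b (inj_eq perm_inj).
  by rewrite (e0 x) // e0.
move=> x xA; have [->|xa] := eqVneq x a.
  by rewrite ea (negPf ba) eq_sym (negPf ra).
have [->|xb] := eqVneq x b; first by rewrite eb (negPf ab) eq_sym (negPf rb).
by rewrite e0 // fx // !inE xa xb.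
Qed.

Let triangles := [set S in fibre | b \notin porbit (S.2 * S.1) a].

Lemma triangles_sub S : S \in triangles ->
  [/\ 0 < p, remove_edge S \in stub_maps (A :\ a :\ b) r p.+1 &
      add_triangle (remove_edge S) = S].
Proof.
rewrite inE => /andP[/fibreP]; case: S => s alpha /= [v sr ea eb er] nab.
case/and5P: v => sOn mA spA plA fdA.
have phir : (alpha * s) r = a by rewrite permM er.
have phia : porbit (alpha * s) a = porbit (alpha *
  s) r by rewrite -(porbit_apply _ r) phir.
have [fr f3] := face_degreesP _ _ _ _ fdA.
have b3 : #|porbit (alpha * s) b| = 3 by apply: f3; rewrite // -phia.
(* The outer orbit contains the two distinct darts r and a. *)
have p_gt0 : 0 < p.
  rewrite lt0n; apply: contra ra => /eqP p0; move: fr; rewrite p0 => /eqP/cards1P[y e].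
  have := porbit_id (alpha * s) r; have := porbit_id (alpha * s) a.
  by rewrite phia e !inE => /eqP-> /eqP->.
have [aOn0 inv0 fx0] := cut_matching mA ea.
split=> //.
  rewrite inE; apply/and5P; split=> /=.
  - by apply: perm_on_detach; apply: perm_on_detach.
  - by apply/matchingP; split=> //; rewrite !inE ra rb.
  - by rewrite (tri_spanning A ra rb ab sr ea eb).
  - by rewrite (tri_planar ra rb ab sr ea eb).
  by rewrite (tri_faces ra rb ab sr er ea eb).
set phi := alpha * s in phir phia fr f3 b3 nab.
have [d1b d2b d21] : [/\ phi b != b, phi (phi b) != b & phi (phi b) != phi b].
  by apply: card_porbit_gt; rewrite b3.
have d3b := porbit3_cycle b3.
have notorb y : y \in porbit phi b -> y != a.
  by move=> yb; apply: contraNneq nab => <-; rewrite porbit_sym.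
have d1a : phi b != a by apply: notorb; rewrite -{1}(expg1 phi) mem_porbit.
have d2a : phi (phi b) != a.
  by apply: notorb; rewrite -eq_porbit_mem !porbit_apply.
have sa : s a = phi b by rewrite permM eb.
have sb : s b = phi a by rewrite permM ea.
have phiaa : phi a != a by rewrite -{2}phir (inj_eq perm_inj) eq_sym.
have detb : detach a s b = phi a by rewrite detachE // sb (negPf phiaa).
(* Removal bypasses a and b. On the new outer face r is therefore followed by [phi b], [phi (phi b)]
   and [phi a]; the first and the last of these are [s a] and [s b], the places where [add_triangle]
   reinserts a and b. *)
have phi2E x : x != a -> x != b -> ((tperm a b * alpha) * detach b (detach a s)) x =
    let v := if phi x == a then phi b else phi x in if v == b then phi a else v.
  move=> xa xb; have ax : (tperm a b * alpha) x = alpha x.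
    by rewrite permM tpermD // eq_sym.
  rewrite permM ax detachE; last by rewrite -ea (inj_eq perm_inj).
  rewrite detb detachE ?sa; last by rewrite -eb (inj_eq perm_inj).
  by rewrite /phi !permM.
rewrite /add_triangle /remove_edge /= tpermKg; congr (_, _).
have e1 : ((tperm a b * alpha) * detach b (detach a s)) r = phi b.
  by rewrite phi2E // phir eqxx /= (negPf d1b).
rewrite e1.
have e2 : ((tperm a b * alpha) * detach b (detach a s)) (phi b) = phi (phi b).
  by rewrite phi2E // (negPf d2a) /= (negPf d2b).
rewrite e2.
have e3 : ((tperm a b * alpha) * detach b (detach a s)) (phi (phi b)) = phi a.
  by rewrite phi2E // d3b (negPf ba) /= eqxx.
rewrite e3 -pmulA tperm_disjointC //; last first.
- by rewrite (inj_eq perm_inj).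
- by rewrite eq_sym.
by rewrite pmulA -detb detachK -sa detachK.
Qed.

Lemma add_triangle_sub S : 0 < p -> S \in stub_maps (A :\ a :\ b) r p.+1 ->
  add_triangle S \in triangles /\ remove_edge (add_triangle S) = S.
Proof.
move=> p_gt0; case: S => s2 alpha0; rewrite inE /= => /and5P[sOn mA spA plA fdA].
have [aOn _ inv fx] := matchingP _ _ _ mA.
have [fr f3] := face_degreesP _ _ _ _ fdA.
have nA y z : y \in A :\ a :\ b -> z \in [set a; b] -> y != z.
  by rewrite !inE => /and3P[yb ya _] /orP[] /eqP->.
have s2a : s2 a = a by rewrite (out_perm sOn) // !inE eqxx andbF.
have s2b : s2 b = b by rewrite (out_perm sOn) // !inE eqxx.
have a0a : alpha0 a = a by rewrite (out_perm aOn) // !inE eqxx andbF.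
have a0b : alpha0 b = b by rewrite (out_perm aOn) // !inE eqxx.
have rA' : r \in A :\ a :\ b by rewrite !inE ra rb.
have a0r : alpha0 r = r by apply/eqP; rewrite fx.
set phi := alpha0 * s2 in fr f3 *.
have phiOn : perm_on (A :\ a :\ b) phi by exact: perm_onM.
(* As p > 0, the outer orbit has p + 2 >= 3 darts, so that d1, d2 and d3 below are distinct; d3 may
   be the stub r itself. *)
have [|n1 n2 n3] := @card_porbit_gt phi r; first by rewrite fr ltnS ltnS.
have [|m1 m2 m3] := @card_porbit_gt phi (phi r);
  first by rewrite porbit_apply fr ltnS ltnS.
pose d1 := phi r; pose d2 := phi d1; pose d3 := phi d2.
have d1A : d1 \in A :\ a :\ b by rewrite /d1 perm_closed.
have d2A : d2 \in A :\ a :\ b by rewrite /d2 perm_closed.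
have d3A : d3 \in A :\ a :\ b by rewrite /d3 perm_closed.
have na y : y \in A :\ a :\ b -> y != a by move=> yA; rewrite (nA _ _ yA) // !inE eqxx.
have nb y : y \in A :\ a :\ b -> y != b by move=> yA;
  rewrite (nA _ _ yA) // !inE eqxx orbT.
have na' y : y \in A :\ a :\ b -> a != y by rewrite eq_sym; exact: na.
have nb' y : y \in A :\ a :\ b -> b != y by rewrite eq_sym; exact: nb.
have subA y : y \in A :\ a :\ b -> y \in A by rewrite !inE => /and3P[].
pose s := s2 * tperm a d1 * tperm b d3.
pose alpha := tperm a b * alpha0.
have d13 : d1 != d3 by rewrite eq_sym.
have tC : tperm a d1 * tperm b d3 = tperm b d3 * tperm a d1.
  by apply: tperm_disjointC; rewrite ?ab ?na' ?nb.
have sr : s r = a.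
  have s2r : s2 r = d1 by rewrite /d1 permM a0r.
  by rewrite /s !permM s2r tpermR tpermD // eq_sym ?na'.
have sa : s a = d1 by rewrite /s !permM s2a tpermL tpermD // ?nb' // eq_sym.
have ea : alpha a = b by rewrite permM tpermL.
have eb : alpha b = a by rewrite permM tpermR.
have er : alpha r = r by rewrite permM tpermD // eq_sym.
have det1 : detach a s = s2 * tperm b d3.
  by rewrite /detach sa /s -(pmulA s2 (tperm a d1)) tC -!pmulA tperm2 mulg1.
have det2 : detach b (detach a s) = s2.
  rewrite det1 /detach !permM s2b tpermL.
  by rewrite -pmulA tperm2 mulg1.
have cut : tperm a b * alpha = alpha0 by rewrite tpermKg.
have phiE x : x \in A :\ a :\ b -> (alpha * s) x =
    tperm b d3 (tperm a d1 (phi x)).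
  by move=> xA; rewrite /s /alpha /phi !permM (@tpermD _ a b x) ?na' ?nb'.
have pb : (alpha * s) b = d1 by rewrite permM eb.
have p1 : (alpha * s) d1 = d2.
  by rewrite phiE // -/d2 (@tpermD _ a d1) ?na' // 1?eq_sym // tpermD ?nb' // eq_sym.
have p2 : (alpha * s) d2 = b.
  by rewrite phiE // -/d3 (@tpermD _ a d1) ?na' // tpermR.
have [b3 orbb] : #|porbit (alpha * s) b| = 3 /\
    porbit (alpha * s) b = [set b; (alpha * s) b; (alpha * s) ((alpha * s) b)].
  by apply: porbit3P; rewrite pb ?p1 ?p2 ?nb.
have nab : b \notin porbit (alpha * s) a.
  by rewrite porbit_sym orbb pb p1 !inE !negb_or ab !na'.
have E : add_triangle (s2, alpha0) = (s, alpha) by [].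
rewrite E; split; last by rewrite /remove_edge /= det2 cut.
rewrite !inE /= sr ea !eqxx nab !andbT; apply/and5P; split.
- rewrite /s; apply: perm_onM; [apply: perm_onM|].
  + by apply: subset_trans sOn _; apply/subsetP=> x /subA.
  + by apply: perm_on_tperm; rewrite // (subA _ d1A).
  by apply: perm_on_tperm; rewrite // (subA _ d3A).
- exact: join_matching.
- by rewrite -(tri_spanning A ra rb ab sr ea eb nab) det2 cut.
- by rewrite -(tri_planar ra rb ab sr ea eb nab) det2 cut.
by rewrite -(tri_faces ra rb ab sr er ea eb nab b3 rA p) det2 cut.
Qed.

Lemma card_triangles :
  #|triangles| = ((0 < p) * #|stub_maps (A :\ a :\ b) r p.+1|)%N.
Proof.
case: (posnP p) => [p0|p_gt0].
  rewrite p0 mul0n; apply/eqP; rewrite cards_eq0; apply/set0Pn=> -[S] /triangles_sub[].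
  by rewrite p0.
rewrite mul1n -[RHS](@card_in_imset _ _ add_triangle).
  congr #|pred_of_set _|; apply/setP=> S; apply/idP/imsetP=> [ST|[S' S'A ->]].
    by have [_ vS <-] := triangles_sub ST; exists (remove_edge S).
  by have [] := add_triangle_sub p_gt0 S'A.
apply: (can_in_inj (g := remove_edge)) => S SA.
by have [] := add_triangle_sub p_gt0 SA.
Qed.

End Fibre.

End Fibres.

Lemma split_degree p j : j < p.-1 -> p = (j + (p.-2 - j)).+2.
Proof. by lia. Qed.

(** * Stub maps whose root edge is a bridge *)

Section Fibres.
Local Open Scope group_scope.
Variable D : finType.
Implicit Types (s alpha phi : {perm D}) (a b r x y z : D) (A : {set D}) (p : nat).

Lemma restr_permP A s : (forall x, (s x \in A) = (x \in A)) ->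
  perm_on A (restr_perm A s) /\ {in A, restr_perm A s =1 s}.
Proof.
move=> sA; split; first exact: restr_perm_on.
by move=> x xA; apply: restr_permE => //; apply/astabsP=> y; exact: sA.
Qed.

Lemma perm_mul_inj A1 A2 s1 s2 (t1 t2 : {perm D}) : [disjoint A1 & A2] ->
  perm_on A1 s1 -> perm_on A2 s2 -> perm_on A1 t1 -> perm_on A2 t2 ->
  s1 * s2 = t1 * t2 -> s1 = t1 /\ s2 = t2.
Proof.
move=> dA s1A s2A t1A t2A e.
have e1 : s1 = t1.
  apply/permP=> x; have [xA|xA] := boolP (x \in A1); last by rewrite !(out_perm _ xA).
  by rewrite -(disjoint_mull dA s1A s2A xA) e (disjoint_mull dA).
by split=> //; apply: (mulgI s1); rewrite e e1.
Qed.

Lemma perm_mulE A1 A2 s s1 s2 : [disjoint A1 & A2] ->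
  perm_on A1 s1 -> perm_on A2 s2 -> {in A1, s1 =1 s} -> {in A2, s2 =1 s} ->
  (forall x, x \notin A1 -> x \notin A2 -> s x = x) -> s = s1 * s2.
Proof.
move=> dA s1A s2A e1 e2 out; apply/permP=> x.
have [xA|xA] := boolP (x \in A1); first by rewrite (disjoint_mull dA) ?e1.
rewrite (disjoint_mulr _ s1A) //.
by have [xA2|xA2] := boolP (x \in A2); [rewrite e2 | rewrite out // (out_perm s2A)].
Qed.

Section Fibre.
Variables (A : {set D}) (r a b : D) (p : nat).
Hypotheses (rA : r \in A) (aA : a \in A :\ r) (bA : b \in A :\ r :\ a).

Let fibre := [set S in stub_maps A r p | (S.1 r == a) && (S.2 a == b)].

Let ra : r != a. Proof. by move: aA; rewrite !inE eq_sym => /andP[]. Qed.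
Let rb : r != b. Proof. by move: bA; rewrite !inE (eq_sym r) => /and3P[]. Qed.
Let ab : a != b. Proof. by move: bA; rewrite !inE (eq_sym a) => /and3P[]. Qed.
Let ba : b != a. Proof. by rewrite eq_sym. Qed.
Let aA' : a \in A. Proof. by move: aA; rewrite !inE => /andP[]. Qed.
Let bA' : b \in A. Proof. by move: bA; rewrite !inE => /and3P[]. Qed.

Let bridges := [set S in fibre | b \in porbit (S.2 * S.1) a].

Notation pair_of_maps :=
  ({set D} * ('I_p.-1 * (({perm D} * {perm D}) * ({perm D} * {perm D}))))%type.

(** The set [t.1] carries the map at the far end of the bridge, with stub b. The two outer degrees
    add up to p - 2; for p < 2 the index type is empty. *)
Definition bridge_data : {set pair_of_maps} :=
  [set t : pair_of_maps |
    [&& (t.1 \subset A :\ r :\ a) && (b \in t.1),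
        t.2.2.1 \in stub_maps (A :\ a :\: t.1) r t.2.1 &
        t.2.2.2 \in stub_maps t.1 b (p.-2 - t.2.1)]].

(* The stub b of the second map becomes the opposite of the new root edge a.   *)
Definition join_by_bridge (t : pair_of_maps) :=
  (t.2.2.1.1 * t.2.2.2.1 * tperm a (t.2.2.1.1 r),
   tperm a b * (t.2.2.1.2 * t.2.2.2.2)).

Section Data.
Variables (A2 : {set D}) (s1 alpha1 s2 alpha2 : {perm D}) (p1 p2 : nat).
Let A1 := A :\ a :\: A2.
Hypotheses (A2A : A2 \subset A :\ r :\ a) (bA2 : b \in A2).
Hypotheses (v1 : stub_map A1 r p1 s1 alpha1) (v2 : stub_map A2 b p2 s2 alpha2).
Let s := s1 * s2 * tperm a (s1 r).
Let alpha := tperm a b * (alpha1 * alpha2).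

Lemma bridge_disjoint : [disjoint A1 & A2].
Proof.
rewrite disjoints_subset; apply/subsetP=> x.
by rewrite !inE => /andP[].
Qed.

Lemma bridge_root_in : r \in A1.
Proof.
rewrite !inE ra rA !andbT; apply/negP=> /(subsetP A2A).
by rewrite !inE eqxx andbF.
Qed.

Lemma bridge_cover : A = a |: (A1 :|: A2).
Proof.
apply/setP=> x; rewrite !inE; case: eqP => [->|_] //=.
case: (boolP (x \in A2)) => //= xA2; last by rewrite orbF.
by have := subsetP A2A x xA2; rewrite !inE => /and3P[_ _ ->].
Qed.

Lemma bridge_notin : a \notin A1 :|: A2.
Proof.
rewrite !inE eqxx andbF /=; apply/negP=> /(subsetP A2A).
by rewrite !inE eqxx.
Qed.

Let dA := bridge_disjoint.
Let rA1 := bridge_root_in.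
Let aN := bridge_notin.

Lemma bridge_facts :
  [/\ [/\ perm_on A1 s1, perm_on A1 alpha1, perm_on A2 s2 & perm_on A2 alpha2],
      [/\ s r = a, alpha r = r, alpha a = b & alpha b = a],
      detach a s = s1 * s2, tperm a b * alpha = alpha1 * alpha2 &
      b \in porbit (alpha * s) a].
Proof.
case/and5P: v1 => s1A /matchingP[a1A _ inv1 fx1] _ _ _.
case/and5P: v2 => s2A /matchingP[a2A _ inv2 fx2] _ _ _.
have bN1 : b \notin A1 by rewrite (disjointFl dA bA2).
have rN2 : r \notin A2 by rewrite (disjointFr dA rA1).
have [aN1 aN2] : a \notin A1 /\ a \notin A2.
  by move: aN; rewrite inE negb_or => /andP[].
have s0a : (s1 * s2) a = a by rewrite permM (out_perm s1A) // (out_perm s2A).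
have a0a : (alpha1 * alpha2) a = a by rewrite permM (out_perm a1A) // (out_perm a2A).
have a0b : (alpha1 * alpha2) b = b.
  by rewrite permM (out_perm a1A) //; apply/eqP; rewrite fx2.
have a0r : (alpha1 * alpha2) r = r.
  have -> : (alpha1 * alpha2) r = alpha1 r by rewrite (disjoint_mull dA).
  by apply/eqP; rewrite fx1.
have s0r : (s1 * s2) r = s1 r by rewrite (disjoint_mull dA).
have sr : s r = a by rewrite permM s0r tpermR.
have sa : s a = s1 r by rewrite permM s0a tpermL.
have er : alpha r = r by rewrite permM tpermD // eq_sym.
have ea : alpha a = b by rewrite permM tpermL.
have eb : alpha b = a by rewrite permM tpermR.
have det : detach a s = s1 * s2 by rewrite /detach sa /s -pmulA tperm2 mulg1.
have cut : tperm a b * alpha = alpha1 * alpha2 by rewrite tpermKg.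
split=> //; rewrite porbit_sym.
have -> : alpha * s = tperm a b * ((alpha1 * alpha2) * s) by rewrite pmulA.
(* If a and b shared a face of the cut map, that face would also contain r, which precedes a on it;
   but apart from a the face of b stays within A2. *)
rewrite mem_porbit_tperm //; apply/negP=> ain.
have : r \in porbit (alpha1 * alpha2 * s) b.
  have e : (alpha1 * alpha2 * s) r = a by rewrite permM a0r.
  by move: ain; rewrite -!eq_porbit_mem => /eqP<-; rewrite -e porbit_apply.
have : porbit (detach a (alpha1 * alpha2 * s)) b = porbit (alpha2 * s2) b.
  rewrite detach_mul // det (face_mul _ _ dA s1A a2A) (porbit_mul _ dA) ?perm_onM //.
  by rewrite (negPf bN1).
rewrite porbit_detach // => e rin.
have : r \in porbit (alpha2 * s2) b by rewrite -e !inE ra.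
by move/(subsetP (porbit_on (perm_onM a2A s2A) bA2)); apply/negP.
Qed.

(** This recovers A2 from the joined map, and with it the two factors; injectivity of
    [join_by_bridge] follows. *)
Lemma bridge_end_component x :
  linked (detach a s) (tperm a b * alpha) b x = (x \in A2).
Proof.
have [[s1A a1A s2A a2A] _ -> -> _] := bridge_facts.
have bN1 : b \notin A1 by rewrite (disjointFl dA bA2).
rewrite (linked_mulr dA) //; apply/idP/idP=> [|xA]; first exact: linked_on.
by case/and5P: v2 => _ _ /forall_inP/(_ x xA).
Qed.

Lemma join_by_bridge_valid : p = (p1 + p2).+2 ->
  stub_map A r p s alpha /\ s r = a /\ alpha a = b.
Proof.
move=> pE; have [[s1A a1A s2A a2A] [sr er ea eb] det cut bphi] := bridge_facts.
split=> //; case/and5P: (v1) => _ m1 sp1 pl1 fd1; case/and5P: (v2) => _ m2 sp2 pl2 fd2.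
case/matchingP: m1 => _ _ inv1 fx1; case/matchingP: m2 => _ _ inv2 fx2.
have sub1 : A1 \subset A by apply/subsetP=> x; rewrite !inE => /and3P[].
have sub2 : A2 \subset A.
  by apply: subset_trans A2A _; apply/subsetP=> x; rewrite !inE => /and3P[].
apply/and5P; split.
- apply: perm_onM; [apply: perm_onM|].
  + exact: subset_trans s1A sub1.
  + exact: subset_trans s2A sub2.
  by apply: perm_on_tperm => //; apply: (subsetP sub1); rewrite perm_closed.
- apply: join_matching => //.
  + apply/subsetP=> x; rewrite !inE => xm.
    have [xA1|xA1] := boolP (x \in A1).
      have xa : x != a by move: xA1; rewrite !inE => /and3P[].
      rewrite xa (subsetP sub1 _ xA1) !andbT; apply: contraTneq xA1 => ->.
      by rewrite (disjointFl dA bA2).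
    have xA2 : x \in A2.
      by apply: contraR xm => xA2; rewrite permM (out_perm a1A) // (out_perm a2A).
    move: xm; rewrite (disjoint_mulr _ a1A) // fx2 // => ->.
    by have := subsetP A2A x xA2; rewrite !inE => /and3P[-> _ ->].
  + have e y : alpha2 (alpha1 y) = alpha1 (alpha2 y).
      by rewrite -!permM (perm_onC a1A a2A dA).
    by move=> x; rewrite !permM (e x) inv1 inv2.
  move=> x; rewrite !inE => /and3P[xb xa xA].
  have [xA1|xA1] := boolP (x \in A1); first by rewrite (disjoint_mull dA) // fx1.
  have xA2 : x \in A2.
    by move: xA1; rewrite !inE xa xA !andbT negbK.
  rewrite (disjoint_mulr _ a1A) // fx2 // (negPf xb); apply/esym/negP=> /eqP xr.
  by move: xA1; rewrite xr rA1.
- by rewrite (bridge_spanning ra ab sr ea eb dA rA1 bA2 aN bridge_cover s1A a1A s2A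
  a2A) // sp1.
- by rewrite (bridge_planar ra ab sr ea eb dA rA1 bA2 s1A a1A s2A a2A) // pl1.
by apply/(bridge_faces ra rb ab sr er eb dA rA1 bA2 aN bridge_cover s1A a1A s2A
  a2A) => //; exists p1, p2.
Qed.

End Data.

Lemma join_by_bridge_sub t : t \in bridge_data -> join_by_bridge t \in bridges.
Proof.
case: t => A2 [j [[s1 alpha1] [s2 alpha2]]].
rewrite inE /= => /and3P[/andP[A2A bA2]]; rewrite inE /= => v1; rewrite inE /= => v2.
have pE := split_degree (ltn_ord j).
have [v [sr ea]] := join_by_bridge_valid A2A bA2 v1 v2 pE.
have [_ _ _ _ bphi] := bridge_facts A2A bA2 v1 v2.
by rewrite !inE /= sr ea !eqxx v.
Qed.

Lemma join_by_bridge_inj : {in bridge_data &, injective join_by_bridge}.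
Proof.
case=> A2 [j [[s1 alpha1] [s2 alpha2]]]; case=> A2' [j' [[s1' alpha1'] [s2' alpha2']]].
rewrite inE /= => /and3P[/andP[A2A bA2]]; rewrite inE /= => v1; rewrite inE /= => v2.
rewrite inE /= => /and3P[/andP[A2A' bA2']]; rewrite inE /= => v1';
  rewrite inE /= => v2'.
have [[s1A a1A s2A a2A] _ det cut _] := bridge_facts A2A bA2 v1 v2.
have [[s1A' a1A' s2A' a2A'] _ det' cut' _] := bridge_facts A2A' bA2' v1' v2'.
have c := bridge_end_component A2A bA2 v1 v2.
have c' := bridge_end_component A2A' bA2' v1' v2'.
rewrite /join_by_bridge /= => -[es ea].
have eA : A2 = A2' by apply/setP=> x; rewrite -c -c' es ea.
move: det cut; rewrite es ea det' cut' => e1 e2; move: v1' s1A' a1A' s2A' a2A';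
  rewrite -eA.
move=> v1' s1A' a1A' s2A' a2A'.
have dA := bridge_disjoint A2.
have [-> ->] := perm_mul_inj dA s1A' s2A' s1A s2A e1.
have [e3 ->] := perm_mul_inj dA a1A' a2A' a1A a2A e2; rewrite -e3.
have [e4 _] := perm_mul_inj dA s1A' s2A' s1A s2A e1.
suff -> : j = j' by rewrite e3.
apply/val_inj => /=.
case/and5P: v1 => _ _ _ _ /face_degreesP[f1 _];
  case/and5P: v1' => _ _ _ _ /face_degreesP[f1' _].
by move: f1; rewrite -e3 -e4 f1' => -[].
Qed.

(** The set A2 is the component of b once the edge is cut and a is detached; by [planar_cut] it does
    not contain r. Both permutations preserve A2 and its complement in [A :\ a], and their
    restrictions are the two maps. *)
Lemma bridges_sub S : S \in bridges -> exists2 t, t \in bridge_data & S =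
  join_by_bridge t.
Proof.
rewrite inE => /andP[/(fibreP rA)]; case: S => s alpha /= [v sr ea eb er] bphi.
case/and5P: v => sOn mA spA plA fdA.
have [aOn0 inv0 fx0] := cut_matching mA ea.
have [pl0 lab] := planar_cut ab ea plA; rewrite bphi /= in lab.
set alpha0 := tperm a b * alpha in aOn0 inv0 fx0 pl0 lab.
have a0a : alpha0 a = a by exact: cut_fixl.
have a0b : alpha0 b = b by exact: cut_fixr.
pose s0 := detach a s; pose A2 := [set x | linked s0 alpha0 b x].
have s0On : perm_on (A :\ a) s0 by exact: perm_on_detach.
have aOn0' : perm_on (A :\ a) alpha0.
  by apply: subset_trans aOn0 _; apply/subsetP=> x; rewrite !inE => /and3P[_ -> ->].
have bAa : b \in A :\ a by rewrite !inE ba.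
have bA2 : b \in A2 by rewrite inE linked_refl.
have A2A : A2 \subset A :\ r :\ a.
  apply/subsetP=> x; rewrite inE => bx; have := linked_on s0On aOn0' bAa bx.
  rewrite !inE => /andP[-> ->]; rewrite !andbT.
  apply/eqP=> xr; move: bx; rewrite xr linked_detach // => /andP[br _].
  case/negP: (negbT lab); rewrite linked_sym; apply: linked_trans br _.
  by rewrite -sr linkedl.
pose A1 := A :\ a :\: A2.
have dA := bridge_disjoint A2.
have cl_s2 x : (s0 x \in A2) = (x \in A2) by rewrite !inE linked_perm.
have cl_a2 x : (alpha0 x \in A2) = (x \in A2).
  rewrite !inE; apply/idP/idP=> H; apply: linked_trans H _; last exact: linkedr.
  by rewrite linked_sym linkedr.
have cl_s1 x : (s0 x \in A1) = (x \in A1) by rewrite !(inE,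
  cl_s2) -!in_setD1 perm_closed.
have cl_a1 x : (alpha0 x \in A1) = (x \in A1) by rewrite in_setD cl_a2 perm_closed
  // -in_setD.
have [s1A s1E] := restr_permP cl_s1; have [a1A a1E] := restr_permP cl_a1.
have [s2A s2E] := restr_permP cl_s2; have [a2A a2E] := restr_permP cl_a2.
have out x : x \notin A1 -> x \notin A2 -> x \notin A :\ a.
  by move=> x1 x2; apply: contra x1 => xA; rewrite /A1 in_setD x2.
have def_s : detach a s = restr_perm A1 s0 * restr_perm A2 s0.
  by apply: (perm_mulE dA) => // x x1 x2; rewrite (out_perm s0On) // out.
have def_a : alpha0 = restr_perm A1 alpha0 * restr_perm A2 alpha0.
  by apply: (perm_mulE dA) => // x x1 x2; rewrite (out_perm aOn0') // out.
have rA1 := bridge_root_in A2A.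
have aN := bridge_notin A2A.
have cov := bridge_cover A2A.
have := bridge_spanning ra ab sr ea eb dA rA1 bA2 aN cov s1A a1A s2A a2A def_s def_a.
rewrite spA => /esym/andP[sp1 sp2].
have := bridge_planar ra ab sr ea eb dA rA1 bA2 s1A a1A s2A a2A def_s def_a bphi.
rewrite plA => /esym/andP[pl1 pl2].
have := bridge_faces ra rb ab sr er eb dA rA1 bA2 aN cov s1A a1A s2A a2A def_s
  def_a bphi p.
case=> /(_ fdA) [p1 [p2 [pE fd1 fd2]]] _.
have jlt : p1 < p.-1 by rewrite pE /= ltnS leq_addr.
have inv1 (B : {set D}) : (forall x, (alpha0 x \in B) = (x \in B)) ->
    forall x, restr_perm B alpha0 (restr_perm B alpha0 x) = x.
  move=> cl x; have [On E] := restr_permP cl; have [xB|xB] := boolP (x \in B).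
    by rewrite !E ?cl.
  by rewrite !(out_perm On).
exists (A2, (Ordinal jlt, ((restr_perm A1 s0, restr_perm A1 alpha0),
                           (restr_perm A2 s0, restr_perm A2 alpha0)))).
  rewrite !inE /= linked_refl A2A /=; apply/andP; split; apply/and5P; split=> //.
  - apply/matchingP; split=> // [|x xA]; first exact: inv1.
    rewrite a1E // fx0 //; move: (xA); rewrite !inE => /and3P[xA2 -> ->].
    by rewrite !andbT; apply: contraNneq xA2 => ->; exact: linked_refl.
  - apply/matchingP; split=> // [|x xA]; first exact: inv1.
    rewrite a2E //; have := subsetP A2A x xA; rewrite !inE => /and3P[xa xr xA'].
    have [->|xb] := eqVneq x b; first by rewrite a0b eqxx.
    by rewrite fx0 ?(negPf xr) // !inE xb xa xA'.
  by rewrite pE /= addKn.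
rewrite /join_by_bridge /= -def_s -def_a s1E //.
have -> : s0 r = s a by rewrite /s0 detachE // sr eqxx.
by rewrite detachK /alpha0 tpermKg.
Qed.

Lemma card_bridges : #|bridges| =
  \sum_(A2 : {set D} | (A2 \subset A :\ r :\ a) && (b \in A2)) \sum_(j < p.-1)
     #|stub_maps (A :\ a :\: A2) r j| * #|stub_maps A2 b (p.-2 - j)|.
Proof.
transitivity #|bridge_data|.
  rewrite -(card_in_imset join_by_bridge_inj); congr #|pred_of_set _|.
  apply/setP=> S; apply/idP/imsetP=> [/bridges_sub[t tB ->]|[t tB ->]].
    by exists t.
  exact: join_by_bridge_sub.
rewrite -sum1_card.
under [RHS]eq_bigr => A2 _ do
  under eq_bigr => j _ do rewrite -cardsX -sum1_card.
under [RHS]eq_bigr => A2 _ do rewrite pair_big_dep /=.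
rewrite pair_big_dep /=; apply: eq_bigl => -[A2 [j [S1 S2]]].
by rewrite !inE /= -!andbA.
Qed.

End Fibre.

End Fibres.

(** * The number of labelled maps *)

(** By [card_stub_maps] this is the number of stub maps with k darts, stub included, and outer
    degree p, divided by (k - 1)!. The first argument f is fuel; any f >= k gives the same value. In
    the sum, i is the number of darts of the map beyond the bridge. *)
Fixpoint stub_count_rec (f k p : nat) : nat :=
  if f is f'.+1 then
    ((k == 1) && (p == 0)) + (0 < p) * stub_count_rec f' (k - 2) p.+1 +
    \sum_(i < k) \sum_(j < p.-1)
       stub_count_rec f' (k.-1 - i) j * stub_count_rec f' i (p.-2 - j)
  else 0.

Definition stub_count k p := stub_count_rec k k p.

Lemma stub_count_rec0 f p : stub_count_rec f 0 p = 0.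
Proof. by elim: f p => //= f IHf p; rewrite big_ord0 IHf muln0. Qed.

Lemma stub_count_rec_stable f f' k p : k <= f -> k <= f' ->
  stub_count_rec f k p = stub_count_rec f' k p.
Proof.
elim: f f' k p => [|f IHf] [|f'] k p; rewrite ?leqn0.
- by [].
- by move=> /eqP-> _; rewrite !stub_count_rec0.
- by move=> _ /eqP->; rewrite !stub_count_rec0.
case: k => [|k] kf kf'; first by rewrite !stub_count_rec0.
rewrite /= (IHf f' (k.+1 - 2)); [|lia|lia]; congr (_ + _).
apply: eq_bigr => i _; apply: eq_bigr => j _; have := ltn_ord i => ilt.
by rewrite (IHf f' (k - i)) ?(IHf f' i) //; lia.
Qed.

Lemma stub_countE k p : stub_count k p =
  ((k == 1) && (p == 0)) + (0 < p) * stub_count (k - 2) p.+1 +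
  \sum_(i < k) \sum_(j < p.-1)
     stub_count (k.-1 - i) j * stub_count i (p.-2 - j).
Proof.
case: k => [|k]; first by rewrite /stub_count /= big_ord0 muln0.
rewrite {1}/stub_count [LHS]/=; congr (_ + _ * _ + _).
  by apply: stub_count_rec_stable; lia.
apply: eq_bigr => i _; apply: eq_bigr => j _; have := ltn_ord i => ilt.
by congr (_ * _); apply: stub_count_rec_stable; rewrite /=; lia.
Qed.

Lemma stub_count0 p : stub_count 0 p = 0.
Proof. exact: stub_count_rec0. Qed.

Section Count.
Variable D : finType.
Implicit Types (a b r x y z : D) (A : {set D}) (p k : nat).
Local Open Scope group_scope.

Lemma num_cycles1 : num_cycles (1 : {perm D}) = num_points D.
Proof.
rewrite /num_cycles /num_points /porbits -[RHS](card_imset _ (@set1_inj D)).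
congr #|pred_of_set _|; apply: eq_imset => x; apply/setP=> y.
rewrite mem_porbit_linked linked_fixed ?perm1 //.
by rewrite inE.
Qed.

Lemma stub_map_trivial r : stub_map [set r] r 0 1 1.
Proof.
apply/and5P; split.
- exact: perm_on1.
- apply/matchingP; split=> [||x|x]; rewrite ?perm_on1 ?perm1 ?inE //.
  by move=> /eqP->; rewrite !eqxx.
- by apply/forall_inP=> x; rewrite inE => /eqP->; exact: linked_refl.
- by rewrite /planar mulg1 -num_cyclesE num_cycles1; lia.
have or : porbit (1 * 1 : {perm D}) r = [set r].
  by apply/setP=> y; rewrite mulg1 mem_porbit_linked linked_fixed ?perm1 // inE.
apply/face_degreesP; split; first by rewrite or cards1.
by move=> x; rewrite inE => /eqP->; rewrite porbit_id.
Qed.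

Lemma card_stub_maps1 r p : #|stub_maps [set r] r p| = (p == 0).
Proof.
have sub S : S \in stub_maps [set r] r p -> S = (1, 1) /\ p = 0.
  case: S => s alpha; rewrite inE => /and5P[/= sOn /matchingP[aOn _ _ _] _ _].
  have -> : s = 1 by apply: perm_on_id sOn _; rewrite cards1.
  have -> : alpha = 1 by apply: perm_on_id aOn _; rewrite cards1.
  case/face_degreesP=> + _; rewrite mulg1 => or; split=> //.
  have : porbit (1 : {perm D}) r = [set r].
    by apply/setP=> y; rewrite mem_porbit_linked linked_fixed ?perm1 // inE.
  by move=> E; move: or; rewrite E cards1 => -[].
case: eqP => [p0|pn0]; last first.
  by apply/eqP; rewrite cards_eq0; apply/set0Pn=> -[S /sub[_ /pn0]].
apply/eqP/cards1P; exists (1, 1); apply/setP=> S; rewrite [in RHS]inE.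
apply/idP/eqP=> [/sub[] //|->]; rewrite inE p0; exact: stub_map_trivial.
Qed.

Section Recursion.
Variables (A : {set D}) (r : D) (p : nat).
Hypotheses (rA : r \in A) (A2 : 1 < #|A|).

(** If s fixed the stub, then r would be a component by itself, whereas the map spans more than one
    dart. *)
Lemma stub_map_root S : S \in stub_maps A r p ->
  (S.1 r \in A :\ r) && (S.2 (S.1 r) \in A :\ r :\ S.1 r).
Proof.
case: S => s alpha; rewrite inE /= => /and5P[sOn /matchingP[aOn _ inv fx] sp _ _].
have ar : alpha r = r by apply/eqP; rewrite fx.
have sr : s r != r.
  apply: contraTneq A2 => sr; rewrite -leqNgt.
  suff -> : A = [set r] by rewrite cards1.
  apply/setP=> x; rewrite inE; apply/idP/eqP=> [xA|-> //].
  by apply/eqP; rewrite -(linked_fixed x sr ar); exact: (forall_inP sp).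
have srA : s r \in A by rewrite perm_closed.
rewrite !inE sr srA perm_closed // srA fx // sr !andbT /=.
by rewrite -{2}ar (inj_eq perm_inj).
Qed.

(** Here a is the dart after the stub and b its opposite; the maps with given a and b are sorted by
    whether both lie on one face. *)
Lemma card_stub_maps_rec :
  #|stub_maps A r p| = (\sum_(a in A :\ r) \sum_(b in A :\ r :\ a)
    ((0 < p) * #|stub_maps (A :\ a :\ b) r p.+1| +
     \sum_(A2 : {set D} | (A2 \subset A :\ r :\ a) && (b \in A2)) \sum_(j < p.-1)
       #|stub_maps (A :\ a :\: A2) r j| * #|stub_maps A2 b (p.-2 - j)|))%N.
Proof.
rewrite -sum1_card.
rewrite (partition_big (fun S : {perm D} *
  {perm D} => S.1 r) (fun a => a \in A :\ r)) /=; last first.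
  by move=> S /stub_map_root/andP[].
apply: eq_bigr => a aA.
rewrite (partition_big (fun S : {perm D} *
  {perm D} => S.2 a) (fun b => b \in A :\ r :\ a)) /=; last first.
  by move=> S /andP[/stub_map_root/andP[_ +] /eqP e]; rewrite e.
apply: eq_bigr => b bA.
rewrite -(card_triangles p rA aA bA) -(card_bridges p rA aA bA).
rewrite (bigID (fun S : {perm D} * {perm D} => b \notin porbit (S.2 * S.1) a)) /=.
congr (_ + _)%N; rewrite sum1dep_card; apply: eq_card => S; rewrite !inE -!andbA //.
by rewrite negbK.
Qed.

End Recursion.

Lemma sum_subsets (X : {set D}) (G : nat -> nat) :
  (\sum_(B : {set D} | B \subset X) G #|B| = \sum_(i < #|X|.+1) 'C(#|X|, i) * G i)%N.
Proof.
rewrite (partition_big (fun B : {set D} => inord #|B| : 'I_#|X|.+1) xpredT) //=.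
apply: eq_bigr => i _.
rewrite (eq_bigr (fun=> G i)); last first.
  move=> B /andP[BX /eqP <-]; rewrite inordK // ltnS.
  exact: subset_leq_card.
rewrite sum_nat_const; congr (_ * _)%N.
rewrite -cards_draws; apply: eq_card => B; rewrite !inE /in_mem /=.
have [BX|//] := boolP (B \subset X); apply/eqP/eqP=> [<-|e].
  by rewrite inordK // ltnS subset_leq_card.
by apply/val_inj; rewrite /= e inordK.
Qed.

(** All darts but the stub are labelled freely. With m = k - 2 there are m + 1 choices of a. In the
    triangle case m choices of b and (m - 1)! labellings remain. In the bridge case ['C(m, i) * i]
    choices of A2 and b remain when A2 has i darts, and the two smaller maps contribute (m - i)! and
    (i - 1)!; the product of these factors is m!. *)
Theorem card_stub_maps A r p : r \in A ->
  #|stub_maps A r p| = ((#|A|.-1)`! * stub_count #|A| p)%N.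
Proof.
have [n] := ubnP #|A|; elim: n A r p => // n IHn A r p; rewrite ltnS => leA rA.
have [A2|] := ltnP 1 #|A|; last first.
  move=> A1; have -> : A = [set r].
    by apply/esym/eqP; rewrite eqEcard sub1set rA cards1.
  rewrite card_stub_maps1 cards1 stub_countE /= big_ord1 stub_count0 muln0.
  by rewrite big1 ?addn0 ?mul1n // => j _; rewrite stub_count0.
rewrite card_stub_maps_rec //; set k := #|A| in leA A2 *.
have kE : k = (k - 2).+2 by lia.
set m := k - 2 in kE.
pose G (i : nat) := (\sum_(j < p.-1) ((m - i)`! * stub_count (m.+1 - i) j *
                     ((i.-1)`! * stub_count i (p.-2 - j))))%N.
have step a : a \in A :\ r ->
  (\sum_(b in A :\ r :\ a)
    ((0 < p) * #|stub_maps (A :\ a :\ b) r p.+1| +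
     \sum_(A2 : {set D} | (A2 \subset A :\ r :\ a) && (b \in A2)) \sum_(j < p.-1)
       #|stub_maps (A :\ a :\: A2) r j| * #|stub_maps A2 b (p.-2 - j)|) =
   m * ((0 < p) * ((m.-1)`! * stub_count m p.+1)) +
   \sum_(i < m.+1) 'C(m, i) * (i * G i))%N.
  move=> aA; have [ar aA'] : a != r /\ a \in A by move: aA; rewrite !inE => /andP[].
  have cX : #|A :\ r :\ a| = m.
    by have := cardsD1 r A; have := cardsD1 a (A :\ r); rewrite rA aA -/k; lia.
  have cAa : #|A :\ a| = m.+1.
    by have := cardsD1 a A; rewrite aA' -/k; lia.
  rewrite big_split /=; congr (_ + _)%N.
    rewrite -[X in (X * _)%N]cX -sum_nat_const; apply: eq_bigr => b bX.
    have cAb : #|A :\ a :\ b| = m.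
      have := cardsD1 b (A :\ a); move: bX; rewrite !inE => /and3P[-> _ ->].
      by rewrite cAa; lia.
    have rAb : r \in A :\ a :\ b.
      by move: bX; rewrite !inE rA (eq_sym r) (eq_sym r) ar => /and3P[_ -> _].
    by rewrite IHn ?cAb //; lia.
  rewrite -[in RHS]cX -(sum_subsets _ (fun i => i * G i)%N).
  rewrite (exchange_big_dep (fun B : {set D} => B \subset A :\ r :\ a)) /=; last first.
    by move=> b B _ /andP[].
  apply: eq_bigr => B BX; rewrite BX /=.
  rewrite (eq_bigl (fun b => b \in B)); last first.
    move=> b; case: (boolP (b \in B)) => bB; last by rewrite andbF.
    by rewrite (subsetP BX).
  rewrite -sum_nat_const; apply: eq_bigr => b bB; rewrite /G.
  have cB : #|B| <= m by rewrite -cX subset_leq_card.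
  have cC : #|A :\ a :\: B| = m.+1 - #|B|.
    rewrite cardsD cAa; suff -> : (A :\ a) :&: B = B by [].
    apply/setIidPr/subsetP=> x /(subsetP BX); rewrite !inE => /and3P[-> _ ->] //.
  apply: eq_bigr => j _; congr (_ * _)%N; last by rewrite IHn //; lia.
  rewrite IHn ?cC //; first by congr (_`! * _)%N; lia.
    by lia.
  rewrite !inE rA eq_sym ar !andbT; apply/negP=> /(subsetP BX).
  by rewrite !inE eqxx andbF.
rewrite (eq_bigr _ step) sum_nat_const.
have -> : #|A :\ r| = m.+1 by have := cardsD1 r A; rewrite rA -/k; lia.
have -> : stub_count k p = ((0 < p) * stub_count m p.+1 +
    \sum_(i < m.+2) \sum_(j < p.-1)
      stub_count (m.+1 - i) j * stub_count i (p.-2 - j))%N.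
  by rewrite kE stub_countE /= subSS subSS subn0.
have -> : k.-1 = m.+1 by rewrite kE.
rewrite factS -mulnA; congr (_ * _)%N; rewrite mulnDr; congr (_ + _)%N.
  case: m {kE G step} => [|m] /=; first by rewrite stub_count0 !mul0n !muln0.
  by rewrite factS; ring.
rewrite [in RHS]big_ord_recr /= [X in (_ + X)%N]big1 ?addn0; last first.
  by move=> j _; rewrite subnn stub_count0.
rewrite big_distrr /=; apply: eq_bigr => -[i ilt] _ /=.
case: i ilt => [|i] ilt; first by rewrite mul0n muln0 big1 ?muln0 // => j _;
  rewrite stub_count0 muln0.
rewrite /G /= !big_distrr /=; apply: eq_bigr => j _.
have bf : ('C(m, i.+1) * (i.+1`! * (m - i.+1)`!) = m`!)%N by apply: bin_fact; lia.
by rewrite -bf factS; ring.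
Qed.

End Count.

(** * Rooted maps *)

Lemma perm_on_setT (D : finType) (s : {perm D}) : perm_on [set: D] s.
Proof. by apply/subsetP=> x _; rewrite inE. Qed.

(** * Adding a fixed point, then a stub, to a map *)

Section LiftPerm.
Local Open Scope group_scope.
Variable n : nat.
Implicit Types (s alpha : {perm 'I_n}) (x y d : 'I_n).

Notation lift0 := (@lift n.+1 ord0).
Notation lift_perm0 := (@lift_perm n ord0 ord0).

Lemma lift_perm_unlift (t : {perm 'I_n.+1}) : t ord0 = ord0 ->
  exists s : {perm 'I_n}, t = lift_perm0 s.
Proof.
move=> t0; pose f j := odflt j (unlift ord0 (t (lift0 j))).
have fE j : lift0 (f j) = t (lift0 j).
  rewrite /f; case: unliftP => [k ->//|e].
  by have := neq_lift ord0 j; rewrite -(inj_eq (@perm_inj _ t)) t0 e eqxx.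
have f_inj : injective f.
  by move=> i j /(congr1 lift0); rewrite !fE => /perm_inj/lift_inj.
exists (perm f_inj); apply/permP=> x; case: (unliftP ord0 x) => [j ->|->].
  by rewrite lift_perm_lift permE fE.
by rewrite lift_perm_id.
Qed.

Lemma lift_perm0_inj : injective lift_perm0.
Proof.
move=> s t /permP e; apply/permP=> x; apply: (@lift_inj _ ord0).
by rewrite -!(lift_perm_lift ord0 ord0) e.
Qed.

Lemma linked_lift s alpha x y :
  linked (lift_perm0 s) (lift_perm0 alpha) (lift0 x) (lift0 y) = linked s alpha x y.
Proof.
pose R : rel 'I_n.+1 := fun u v => match unlift ord0 u, unlift ord0 v with
  | Some x, Some y => linked s alpha x y | None, None => true | _, _ => false end.
apply/idP/idP=> [xy|].
  suff : R (lift0 x) (lift0 y) by rewrite /R !liftK.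
  move: xy; apply: linked_ind => [u|v u w|u|u]; rewrite /R.
  - by case: unlift => // z; exact: linked_refl.
  - by case: unlift => [z|]; case: unlift => [z'|] //; case: unlift => [z''|] //;
    exact: linked_trans.
  - case: (unliftP ord0 u) => [j ->|->]; last by rewrite lift_perm_id unlift_none.
    by rewrite lift_perm_lift liftK linkedl.
  case: (unliftP ord0 u) => [j ->|->]; last by rewrite lift_perm_id unlift_none.
  by rewrite lift_perm_lift liftK linkedr.
apply: (@linked_ind _ _ _ (fun x y => linked (lift_perm0 s) (lift_perm0 alpha)
  (lift0 x) (lift0 y))).
- by move=> u; exact: linked_refl.
- by move=> u v w; exact: linked_trans.
- by move=> u; rewrite -(lift_perm_lift ord0 ord0) linkedl.
by move=> u; rewrite -(lift_perm_lift ord0 ord0) linkedr.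
Qed.

Lemma linked_lift_out s alpha x : linked (lift_perm0 s) (lift_perm0 alpha) (lift0
  x) ord0 = false.
Proof. by rewrite linked_sym linked_fixed ?lift_perm_id //
  eq_sym (negPf (neq_lift _ _)). Qed.

Lemma class_lift s alpha x :
  [set y | linked (lift_perm0 s) (lift_perm0 alpha) (lift0 x) y] =
  lift0 @: [set y | linked s alpha x y].
Proof.
apply/setP=> y; rewrite inE; case: (unliftP ord0 y) => [j ->|->].
  by rewrite linked_lift mem_imset ?inE //; exact: lift_inj.
rewrite linked_lift_out; apply/esym/negP=> /imsetP[z _ /eqP].
by rewrite (negPf (neq_lift _ _)).
Qed.

Lemma num_components_lift s alpha :
  num_components (lift_perm0 s) (lift_perm0 alpha) = (num_components s alpha).+1.
Proof.
rewrite /num_components.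
rewrite (@num_classes_split _ _ (@linked_refl _ _ _) (@linked_sym _ _ _)
  (@linked_trans _ _ _) [set ord0]).
  rewrite imset_set1 cards1 add1n; congr _.+1.
  rewrite /num_classes -[RHS](card_imset _ (imset_inj (@lift_inj _ ord0))) -imset_comp.
  congr #|pred_of_set _|; apply/setP=> C; apply/imsetP/imsetP=> -[x].
    rewrite !inE; case: (unliftP ord0 x) => [j ->|->]; last by rewrite eqxx.
    by move=> _ ->; exists j => //; rewrite class_lift.
  by move=> _ ->; exists (lift0 x); rewrite ?class_lift // !inE eq_sym neq_lift.
move=> x y; rewrite !inE; case: (unliftP ord0 x) => [i ->|->].
  case: (unliftP ord0 y) => [j ->|->]; last by rewrite linked_lift_out.
  by rewrite !(eq_sym _ ord0) !(negPf (neq_lift _ _)).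
by rewrite linked_fixed ?lift_perm_id // => /eqP->.
Qed.

Lemma num_cycles_lift s : num_cycles (lift_perm0 s) = (num_cycles s).+1.
Proof. by rewrite !num_cyclesE -num_components_lift lift_perm1. Qed.

Lemma planar_lift s alpha : planar (lift_perm0 s) (lift_perm0 alpha) = planar s alpha.
Proof.
rewrite /planar lift_permM !num_cycles_lift num_components_lift.
by rewrite /num_points !card_ord; apply/idP/idP; lia.
Qed.

Lemma porbit_lift s x : porbit (lift_perm0 s) (lift0 x) = lift0 @: porbit s x.
Proof.
by rewrite porbit_linked -(lift_perm1 ord0) class_lift; congr (_ @: _);
  rewrite porbit_linked.
Qed.

End LiftPerm.

Local Notation opp := Defs.opp.

Section AddStub.
Local Open Scope group_scope.
Variable n : nat.
Implicit Types M : rooted_map 'I_n.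

Notation lift0 := (@lift n.+1 ord0).
Notation lift_perm0 := (@lift_perm n ord0 ord0).

(* The root face has degree p.+1, since face_degrees discounts a stub.         *)
Definition boundary_maps p : {set rooted_map 'I_n} :=
  [set M | planar_map M && face_degrees [set: 'I_n] (root_dart M) p (frot M)].

(* The stub is placed in the corner preceding the root dart.                   *)
Definition add_stub M : {perm 'I_n.+1} * {perm 'I_n.+1} :=
  (lift_perm0 (vrot M) * tperm ord0 (lift0 (root_dart M)), lift_perm0 (opp M)).

Section One.
Variable M : rooted_map 'I_n.
Let s' := (add_stub M).1.
Let alpha' := (add_stub M).2.

Lemma add_stub_root : s' ord0 = lift0 (root_dart M).
Proof. by rewrite permM lift_perm_id tpermL. Qed.

Lemma add_stub_detach : detach ord0 s' = lift_perm0 (vrot M).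
Proof. by rewrite /detach add_stub_root -pmulA tperm2 mulg1. Qed.

Lemma add_stub_opp0 : alpha' ord0 = ord0. Proof. exact: lift_perm_id. Qed.

Lemma add_stub_moved : s' ord0 != ord0.
Proof. by rewrite add_stub_root eq_sym neq_lift. Qed.

Lemma add_stub_planar : planar s' alpha' = planar (vrot M) (opp M).
Proof.
by rewrite -(planar_detach add_stub_opp0 add_stub_moved) add_stub_detach planar_lift.
Qed.

Lemma add_stub_linked x y : linked s' alpha' (lift0 x) (lift0 y) =
  linked (vrot M) (opp M) x y.
Proof.
have := @linked_detach _ ord0 s' alpha' (lift0 x) (lift0 y) add_stub_opp0.
rewrite add_stub_detach linked_lift !(eq_sym _ ord0) neq_lift andbT.
by move/(_ isT).
Qed.

Lemma add_stub_spanning : spanning [set: 'I_n.+1] ord0 s' alpha' = connected_map M.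
Proof.
have l0 : linked s' alpha' ord0 (lift0 (root_dart M)).
  by rewrite -add_stub_root linkedl.
apply/forall_inP/forallP=> [l d|l x _].
  have := l (lift0 d) (in_setT _) => ld; rewrite -[connect _ _ _]add_stub_linked.
  by apply: linked_trans ld; rewrite linked_sym.
case: (unliftP ord0 x) => [j ->|->]; last exact: linked_refl.
by apply: linked_trans l0 _; rewrite add_stub_linked; exact: l.
Qed.

Lemma add_stub_matching : matching [set: 'I_n.+1] ord0 alpha' = edge_involution M.
Proof.
apply/matchingP/forallP=> [[_ _ inv fx] d|e].
  have := inv (lift0 d); have := fx (lift0 d) (in_setT _).
  rewrite /alpha' /= !lift_perm_lift (inj_eq (@lift_inj _ _)) eq_sym.
  by rewrite (eq_sym (lift0 d)) (negPf (neq_lift _ _)) eq_sym => -> /lift_inj->;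
    rewrite eqxx.
split=> [|||x _]; first exact: perm_on_setT.
- exact: in_setT.
- move=> x; case: (unliftP ord0 x) => [j ->|->]; last by rewrite !add_stub_opp0.
  by rewrite /alpha' /= !lift_perm_lift; have /andP[_ /eqP->] := e j.
case: (unliftP ord0 x) => [j ->|->]; last by rewrite add_stub_opp0 !eqxx.
rewrite /alpha' /= lift_perm_lift (inj_eq (@lift_inj _ _)) (eq_sym (lift0 j)).
by rewrite (negPf (neq_lift _ _)); have /andP[/negPf->] := e j.
Qed.

Lemma add_stub_face_detach : detach ord0 (alpha' * s') = lift_perm0 (frot M).
Proof. by rewrite detach_mul ?add_stub_opp0 // add_stub_detach lift_permM. Qed.

Lemma add_stub_porbit d : porbit (alpha' * s') (lift0 d) :\ ord0 =
  lift0 @: porbit (frot M) d.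
Proof. by rewrite -porbit_lift -add_stub_face_detach porbit_detach //
  eq_sym neq_lift. Qed.

Lemma add_stub_porbit_root : porbit (alpha' * s') ord0 =
  ord0 |: lift0 @: porbit (frot M) (root_dart M).
Proof.
have e : (alpha' * s') ord0 = lift0 (root_dart M).
  by rewrite permM add_stub_opp0 add_stub_root.
by rewrite -add_stub_porbit -e porbit_apply setD1K // porbit_id.
Qed.

Lemma mem_add_stub_root d : (lift0 d \in porbit (alpha' * s') ord0) =
  (d \in porbit (frot M) (root_dart M)).
Proof.
rewrite add_stub_porbit_root !inE eq_sym (negPf (neq_lift _ _)) /= mem_imset //.
exact: lift_inj.
Qed.

(** Only the root face changes: its orbit gains the stub and passes from p + 1 to p + 2 darts. *)
Lemma add_stub_faces p : face_degrees [set: 'I_n.+1] ord0 p.+1 (alpha' * s') =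
  face_degrees [set: 'I_n] (root_dart M) p (frot M).
Proof.
have n0 (B : {set 'I_n}) : ord0 \notin lift0 @: B.
  by apply/imsetP=> -[x _ /eqP]; rewrite (negPf (neq_lift _ _)).
have c0 : #|porbit (alpha' * s') ord0| = #|porbit (frot M) (root_dart M)|.+1.
  by rewrite add_stub_porbit_root cardsU1 n0 card_imset //; exact: lift_inj.
have cd d : d \notin porbit (frot M) (root_dart M) ->
    #|porbit (alpha' * s') (lift0 d)| = #|porbit (frot M) d|.
  move=> dr; rewrite -[RHS](card_imset _ (@lift_inj _ ord0)) -add_stub_porbit.
  congr #|pred_of_set _|; apply/setP=> y; rewrite !inE; case: eqP => [->|//].
  by rewrite porbit_sym mem_add_stub_root (negPf dr).
apply/face_degreesP/face_degreesP=> -[cE cF]; split.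
- by move: cE; rewrite c0 => -[].
- by move=> d _ dr; rewrite -cd //; apply: cF; rewrite ?mem_add_stub_root ?in_setT.
- by rewrite c0 cE.
move=> x _; case: (unliftP ord0 x) => [j ->|->]; last by rewrite porbit_id.
by rewrite mem_add_stub_root => jr; rewrite cd // cF ?in_setT.
Qed.

(** For a connected map on 2E darts [planar] reads V + F >= E + 2, and [euler_inequality] is the
    opposite inequality. *)
Lemma planar_mapE : edge_involution M -> connected_map M ->
  planar (vrot M) (opp M) = planar_map M.
Proof.
move=> e c; rewrite /planar_map e c /=.
have c1 : num_components (vrot M) (opp M) = 1%N.
  apply/eqP/cards1P; exists [set: 'I_n]; apply/setP=> C; rewrite inE.
  have l x y : linked (vrot M) (opp M) x y.
    apply: linked_trans (_ : linked _ _ _ (root_dart M)) _; last exact: (forallP c).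
    by rewrite linked_sym; exact: (forallP c).
  apply/imsetP/eqP=> [[x _ ->]|->]; first by apply/setP=> y; rewrite !inE l.
  by exists (root_dart M) => //; apply/setP=> y; rewrite !inE l.
have := euler_inequality (vrot M) (opp M); have := num_edges_double e.
rewrite /planar c1 /num_vertices /num_faces /num_edges.
rewrite -!/(num_cycles _) -/(num_points _) /frot => H1 H2.
by apply/idP/eqP=> H; lia.
Qed.

Lemma add_stubE p : (add_stub M \in stub_maps [set: 'I_n.+1] ord0 p.+1) =
  (M \in boundary_maps p).
Proof.
rewrite !inE /stub_map add_stub_matching add_stub_spanning add_stub_planar
  add_stub_faces.
rewrite perm_on_setT /=; apply/and4P/andP=> [[e c pl fd]|[pm fd]].
  by rewrite -planar_mapE.
case/and3P: (pm) => e c _; split=> //.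
by rewrite planar_mapE.
Qed.

End One.

Lemma add_stub_inj : injective add_stub.
Proof.
move=> M M' e; have e1 := add_stub_root M; have e2 := add_stub_detach M.
move: e1 e2; rewrite e add_stub_root add_stub_detach => /lift_inj er /lift_perm0_inj es.
case: e => _ /lift_perm0_inj eo; case: M M' er es eo => v o r [v' o' r'] /= -> -> ->.
by [].
Qed.

(** The outer degree is positive, so the stub is not alone at its vertex; the dart that follows it
    becomes the root. *)
Lemma add_stub_surj S p : S \in stub_maps [set: 'I_n.+1] ord0 p.+1 ->
  exists M, S = add_stub M.
Proof.
case: S => s alpha; rewrite inE => /and5P[/= _ m sp _ /face_degreesP[or _]].
case/matchingP: m => _ _ _ fx.
have a0 : alpha ord0 = ord0 by apply/eqP; rewrite fx ?in_setT.
have s0 : s ord0 != ord0.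
  apply: contraTneq isT => s0; have : porbit (alpha * s) ord0 = [set ord0].
    apply/setP=> y; rewrite mem_porbit_linked linked_fixed ?perm1 ?inE //.
    by rewrite permM a0.
  by move=> E; move: or; rewrite E cards1.
have [sv dE] := lift_perm_unlift (detach_id ord0 s);
  have [so ->] := lift_perm_unlift a0.
case: (unliftP ord0 (s ord0)) => [j ej|e]; last by rewrite e eqxx in s0.
exists (RootedMap sv so j); rewrite /add_stub /=; congr (_, _).
by rewrite -(detachK ord0 s) dE ej.
Qed.

Lemma card_boundary_maps p : #|boundary_maps p| = (n`! * stub_count n.+1 p.+1)%N.
Proof.
have := card_stub_maps p.+1 (in_setT (ord0 : 'I_n.+1));
  rewrite cardsT card_ord /= => <-.
rewrite -[LHS](card_imset _ add_stub_inj); congr #|pred_of_set _|; apply/setP=> S.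
apply/imsetP/idP=> [[M MB ->]|SB]; first by rewrite add_stubE.
have [M e] := add_stub_surj SB; exists M => //.
by rewrite -add_stubE -e.
Qed.

End AddStub.

(** * Isomorphism classes of rooted maps *)

Section Relabel.
Local Open Scope group_scope.
Variable D : finType.
Implicit Types (M : rooted_map D) (s q : {perm D}).

Lemma porbit_conj s q x : porbit (s ^ q) (q x) = q @: porbit s x.
Proof.
apply/setP=> y; rewrite -(permKV q y) mem_imset; last exact: perm_inj.
apply/porbitP/porbitP=> -[i e]; exists i; last by rewrite e -conjXg permJ.
by apply: (@perm_inj _ q); rewrite e -conjXg permJ.
Qed.

Lemma card_porbits_conj s q : #|porbits (s ^ q)| = #|porbits s|.
Proof.
rewrite -[RHS](card_imset _ (imset_inj (@perm_inj _ q))) /porbits -imset_comp.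
congr #|pred_of_set _|; apply/setP=> C; apply/imsetP/imsetP=> -[x _ ->].
  by exists (q^-1 x) => //=; rewrite -porbit_conj permKV.
by exists (q x); rewrite //= porbit_conj.
Qed.

Lemma frot_relabel q M : frot (relabel q M) = frot M ^ q.
Proof. by rewrite /frot /= conjMg. Qed.

Lemma relabel_triangulation q M : triangulation M -> triangulation (relabel q M).
Proof.
rewrite /triangulation /planar_map /num_vertices /num_edges /num_faces frot_relabel.
rewrite !card_porbits_conj => /andP[/and3P[/forallP e /forallP c ->] t].
rewrite andbT; apply/andP; split; last first.
  case/orP: t => [/forallP t|->]; last by rewrite orbT.
  apply/orP; left; apply/forallP=> d; rewrite -(permKV q d) porbit_conj card_imset //.
  exact: perm_inj.
apply/andP; split; apply/forallP=> d; rewrite -(permKV q d).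
  by rewrite !permJ !(inj_eq perm_inj) e.
have := c (q^-1 d); move: (q^-1 d) => d' /=; move: (root_dart M) => r.
rewrite -!/(linked _ _ _ _).
apply: (@linked_ind _ _ _ (fun x y => linked (vrot M ^ q) (opp M ^ q) (q x) (q y))).
- by move=> u; exact: linked_refl.
- by move=> u v w; exact: linked_trans.
- by move=> u; rewrite -permJ linkedl.
by move=> u; rewrite -permJ linkedr.
Qed.

(* A rooted connected map has no automorphism but the identity.                *)
Lemma relabel_inj M : connected_map M -> injective (fun q => relabel q M).
Proof.
move=> /forallP c q q' [ev eo er]; apply/permP=> x; apply/eqP.
suff /implyP : (q (root_dart M) == q' (root_dart M)) ==> (q x == q' x) by rewrite
  er eqxx; exact.
have := c x; rewrite -/(linked _ _ _ _); move: (root_dart M) x.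
apply: (@linked_ind _ _ _ (fun x y => (q x == q' x) ==> (q y == q' y))).
- by move=> u; exact: implybb.
- by move=> u v w /implyP uv /implyP vw; apply/implyP=> /uv/vw.
- by move=> u; apply/implyP=> /eqP e; rewrite -!(permJ (vrot M)) ev e.
by move=> u; apply/implyP=> /eqP e; rewrite -!(permJ (opp M)) eo e.
Qed.

(** A class is the image of the symmetric group under relabelling, which is injective by
    [relabel_inj]. *)
Lemma card_classes (T : {set rooted_map D}) :
  (forall M, M \in T -> connected_map M) ->
  (forall q M, M \in T -> relabel q M \in T) ->
  #|T| = (#|equivalence_partition (@isomorphic D) T| * #|D|`!)%N.
Proof.
move=> conn closed.
apply: card_uniform_partition; last first.
  by apply: equivalence_partitionP => M M' M'' _ _ _; exact: isomorphic_equiv.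
move=> B /imsetP[M MT ->].
have -> : [set M' in T | isomorphic M M'] = (fun q => relabel q M) @: [set: {perm D}].
  apply/setP=> M'; rewrite inE; apply/andP/imsetP=> [[_ /existsP[q /eqP->]]|[q _ ->]].
    by exists q.
  by split; [exact: closed | apply/existsP; exists q].
rewrite card_imset ?cardsT; last by apply: relabel_inj; exact: conn.
have := card_perm [set: D]; rewrite cardsT => <-; apply: eq_card => q.
by rewrite inE; apply/esym; exact: perm_on_setT.
Qed.

End Relabel.

Lemma num_triangulations_edgesE n m p :
  triangulations 'I_m.*2 n = boundary_maps m.*2 p ->
  num_triangulations_edges n m = stub_count m.*2.+1 p.+1.
Proof.
move=> e; have := card_boundary_maps m.*2 p; rewrite -e.
rewrite (card_classes (D := 'I_m.*2)).
- by rewrite card_ord mulnC => /eqP; rewrite eqn_pmul2l ?fact_gt0 // => /eqP.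
- by move=> M; rewrite inE => /andP[/andP[/and3P[]]].
move=> q M; rewrite !inE => /andP[t /eqP v]; rewrite relabel_triangulation //.
by rewrite /num_vertices card_porbits_conj -v eqxx.
Qed.

Lemma num_triangulations_edges_eq0 n m :
  (if n == 2 then m != 1 else m + 6 != 3 * n)%N -> num_triangulations_edges n m = 0%N.
Proof.
move=> ne; apply/eqP; rewrite cards_eq0.
suff -> : triangulations 'I_m.*2 n = set0 by rewrite /equivalence_partition imset0.
apply/setP=> M; rewrite !inE; apply/negP=> /andP[t /eqP v].
by have := triangulation_edges t v; move: ne; case: ifP => _ /eqP.
Qed.

(** Two vertices force one edge, that is two darts. On two darts, a root face of degree 2 is the
    only face, and Euler's formula turns this into having two vertices. *)
Lemma num_triangulations2 : num_triangulations 2 = stub_count 3 2.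
Proof.
rewrite /num_triangulations (bigD1 (Ordinal (isT : (1 < 3 * 2)%N))) //=.
rewrite big1 ?addn0 => [|m m1]; last first.
  by apply: num_triangulations_edges_eq0 => /=; apply: contraNneq m1 => e;
    apply/eqP/val_inj.
apply: (@num_triangulations_edgesE 2 1 1); apply/setP=> M; rewrite !inE.
have facesE : (num_faces M == 1)%N = face_degrees [set: 'I_2] (root_dart M) 1 (frot M).
  apply/idP/face_degreesP=> [/cards1P[C e]|[or _]].
    have all x : porbit (frot M) x = C.
      by apply/set1P; rewrite -e imset_f.
    have CT : C = setT by apply/setP=> x; rewrite -(all x) porbit_id inE.
    by split=> [|x _]; rewrite !all CT ?cardsT ?card_ord // inE.
  have rT : porbit (frot M) (root_dart M) = setT.
    by apply/eqP; rewrite eqEcard subsetT cardsT card_ord or.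
  apply/cards1P; exists setT; apply/setP=> C; rewrite inE;
    apply/imsetP/eqP=> [[x _ ->]|->].
    by rewrite -rT; apply/eqP; rewrite eq_porbit_mem rT inE.
  by exists (root_dart M).
rewrite -facesE; apply/andP/andP=> [[/andP[pm t] v]|[pm f]].
  split=> //; case/and3P: pm => e _ /eqP E; have := num_edges_double e.
  by rewrite card_ord; move/eqP: v; move: E; rewrite /num_vertices; lia.
case/and3P: (pm) => e _ /eqP E; have := num_edges_double e; rewrite card_ord => H.
have E1 : num_edges M = 1%N by lia.
have V2 : num_vertices M = 2%N by move/eqP: f; lia.
by rewrite /triangulation pm E1 V2 !eqxx orbT.
Qed.

(** There are 3n - 6 edges, hence 6n - 12 darts and one stub. Conversely, a map with that many edges
    and all faces triangular has n vertices by [triangulation_edges]. *)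
Lemma num_triangulations_gt2 n : (2 < n)%N ->
  num_triangulations n = stub_count (6 * n - 11) 3.
Proof.
move=> n2; rewrite /num_triangulations.
have mlt : (3 * n - 6 < 3 * n)%N by lia.
rewrite (bigD1 (Ordinal mlt)) //=.
rewrite big1 ?addn0 => [|m m1]; last first.
  apply: num_triangulations_edges_eq0; rewrite ifN; last by lia.
  by apply: contraNneq m1 => e; apply/eqP/val_inj => /=; lia.
have -> : (6 * n - 11 = (3 * n - 6).*2.+1)%N by lia.
apply: num_triangulations_edgesE; apply/setP=> M; rewrite !inE.
apply/andP/andP=> [[t /eqP v]|[pm fd]].
  have /andP[pm] := t; rewrite pm => /orP[/forallP f3|/andP[/eqP V2 _]]; last by lia.
  split=> //; apply/face_degreesP; split=> [|x _ _]; exact/eqP.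
have [fr f3] := face_degreesP _ _ _ _ fd.
have t : triangulation M.
  rewrite /triangulation pm; apply/orP; left; apply/forallP=> d; apply/eqP.
  have [|dr] := boolP (d \in porbit (frot M) (root_dart M)); last exact: f3.
  by rewrite -eq_porbit_mem => /eqP->.
split=> //; apply/eqP; have := triangulation_edges t erefl.
by case: eqP; lia.
Qed.

(** * The number of maps with a given outer degree *)

Import GRing.Theory.

Lemma stub_count1 p : stub_count 1 p = (p == 0).
Proof.
rewrite stub_countE /= big_ord1 stub_count0 muln0 !addn0.
by rewrite big1 ?addn0 // => j _; rewrite stub_count0.
Qed.

(** This is Euler's formula with v vertices: 2E = k - 1, and f inner triangles satisfy 3f + p = k -
    1, so v - E + f + 1 = 2 becomes k + 2p + 5 = 6v. *)
Lemma stub_count_support k p : stub_count k p != 0 ->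
  exists v, k + 2 * p + 5 = 6 * v.
Proof.
have [n] := ubnP k; elim: n k p => // n IHn k p kn.
rewrite stub_countE !addn_eq0 !negb_and => /orP[/orP[]|].
- by rewrite eqb0 negbK => /andP[/eqP-> /eqP->]; exists 1.
- rewrite muln_eq0 negb_or => /andP[_].
  have [k2|k2] := leqP 2 k; last by have -> : k - 2 = 0 by lia; rewrite stub_count0.
  by case/IHn; [lia|move=> v e; exists v; lia].
rewrite sum_nat_eq0 => /forallPn[i]; rewrite /= sum_nat_eq0 => /forallPn[j] /=.
rewrite muln_eq0 negb_or => /andP[]; have := ltn_ord i; have := ltn_ord j => jl il.
case/IHn; first by lia.
move=> v1 e1 /IHn [|v2 e2]; first by lia.
by exists (v1 + v2); lia.
Qed.

(* The number of rooted planar maps with v vertices, an outer face of degree p *)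
(* and all inner faces of degree 3; Euler's formula gives the number of darts. *)
Definition disk_count v p := stub_count (6 * v - (2 * p + 5)) p.

Lemma disk_count_out v p : 3 * v <= p + 2 -> disk_count v p = 0.
Proof.
by move=> le; rewrite /disk_count; have -> : 6 * v - (2 * p + 5) = 0 by lia;
  exact: stub_count0.
Qed.

Lemma disk_countE v p : disk_count v p =
  ((v == 1) && (p == 0)) + (0 < p) * disk_count v p.+1 +
  \sum_(u < v.+1) \sum_(j < p.-1) disk_count u j * disk_count (v - u) (p.-2 - j).
Proof.
rewrite {1}/disk_count stub_countE; congr (_ + _ + _).
- by case: (p =P 0) => [->|]; rewrite ?andbF // !andbT; congr nat_of_bool; lia.
- by case: p => // p; congr (_ * stub_count _ _); lia.
rewrite exchange_big [RHS]exchange_big /=; apply: eq_bigr => j _.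
set k := 6 * v - (2 * p + 5); set q := p.-2 - j.
have := ltn_ord j => jlt.
pose F i := stub_count (k.-1 - i) j * stub_count i q.
(* By [stub_count_support] a nonzero term i determines the number of vertices of each factor, so it
   is hit by a single u. After the two sums are exchanged, each u contributes at most at the index
   [i0]. *)
pose hit i u := (i + (2 * q + 5) == 6 * (v - u)).
have F_hit (i : 'I_k) : F i = \sum_(u < v.+1) hit i u * F i.
  have [->|Fi] := eqVneq (F i) 0; first by rewrite big1 // => u _; rewrite muln0.
  move: (Fi); rewrite muln_eq0 negb_or => /andP[/stub_count_support[v1 e1]
    /stub_count_support[v2 e2]].
  have ilt := ltn_ord i.
  have vE : v = v1 + v2 by rewrite /k /q in e1 e2 ilt *; lia.
  have v1lt : v1 < v.+1 by lia.
  rewrite (bigD1 (Ordinal v1lt)) //= big1 ?addn0 => [|u /eqP u1].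
    by rewrite /hit (_ : _ == _) ?mul1n //; apply/eqP; lia.
  rewrite /hit; case: eqP => // e; case: u1; apply/val_inj => /=.
  by have := ltn_ord u; lia.
rewrite (eq_bigr _ (fun i _ => F_hit i)) exchange_big /=; apply: eq_bigr => u _.
have := ltn_ord u => ult.
set i0 := 6 * (v - u) - (2 * q + 5).
have [ilt|ige] := ltnP i0 k; last first.
  rewrite big1 => [|i _]; last first.
    rewrite /hit; case: eqP => // e.
    by have := ltn_ord i; rewrite /i0 in ige; lia.
  have [le1|gt1] := leqP (3 * u) (j + 2); first by rewrite disk_count_out.
  have [le2|gt2] := leqP (3 * (v - u)) (q + 2).
    by rewrite [disk_count _ q]disk_count_out ?muln0.
  by exfalso; rewrite /i0 /k /q in ige gt2; lia.
rewrite (bigD1 (Ordinal ilt)) //= big1 ?addn0 => [|i /eqP ii]; last first.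
  rewrite /hit; case: eqP => // e; case: ii; apply/val_inj => /=.
  by rewrite /i0; lia.
have [lt|ge] := ltnP (2 * q + 5) (6 * (v - u)); last first.
  have -> : disk_count (v - u) q = 0 by apply: disk_count_out; lia.
  by rewrite /F (_ : i0 = 0) ?stub_count0 ?muln0 // /i0; lia.
rewrite /hit (_ : _ == _) ?mul1n; last by apply/eqP; rewrite /i0; lia.
by rewrite /F /disk_count; congr (stub_count _ _ * _); rewrite /k /i0 /q in ilt *; lia.
Qed.

Lemma disk_count_vertex v : disk_count v 0 = (v == 1).
Proof.
rewrite disk_countE andbT mul0n addn0 big1 ?addn0 // => u _.
by rewrite big_ord0.
Qed.

Lemma disk_count_step v p : disk_count v p.+1 =
  disk_count v p.+2 + \sum_(u < v.+1) \sum_(j < p) disk_count u j *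
    disk_count (v - u) (p.-1 - j).
Proof. by rewrite disk_countE andbF add0n mul1n. Qed.

(** Writing W_p for the part of outer degree p, the recursion gives W_1 = W_2 = W_3 + W_0^2 with W_0
    = x. Beyond two vertices W_3 counts the triangulations, and W_0^2 = x^2 accounts for the single
    edge. *)
Lemma num_triangulations_disk n :
  (if 2 <= n then num_triangulations n else 0) = disk_count n 1.
Proof.
have e1 : disk_count n 1 = disk_count n 2.
  by rewrite disk_count_step big1 ?addn0 // => u _; rewrite big_ord0.
have [n2|n2] := leqP 2 n; last by rewrite disk_count_out //; lia.
rewrite e1; case: n n2 {e1} => [|[|[|n]]] // _; first by rewrite num_triangulations2.
rewrite num_triangulations_gt2 // disk_count_step /=.
rewrite big1 ?addn0 => [|u _]; first by congr (stub_count _ _); lia.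
rewrite big_ord1 !disk_count_vertex; case: eqP => // ->.
by case: eqP => // e; lia.
Qed.

(** * Formal power series *)

Local Open Scope ring_scope.

Section SeriesTheory.
Variable R : comUnitRingType.
Implicit Types (f g h : fps R) (c : R).

Lemma coefs1 n : coefs (1 : fps R) n = (n == 0%N)%:R. Proof. by []. Qed.
Lemma coefsD f g n : coefs (f + g) n = coefs f n + coefs g n. Proof. by []. Qed.
Lemma coefsN f n : coefs (- f) n = - coefs f n. Proof. by []. Qed.
Lemma coefsM f g n : coefs (f * g) n = \sum_(i < n.+1) coefs f i * coefs g (n - i)%N.
Proof. by []. Qed.

Lemma coefsMn f n k : coefs (f *+ k) n = coefs f n *+ k.
Proof. by elim: k => [|k IHk]; rewrite ?mulr0n // !mulrS coefsD IHk. Qed.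

Lemma coefs_sum (I : Type) (s : seq I) (P : pred I) (F : I -> fps R) n :
  coefs (\sum_(i <- s | P i) F i) n = \sum_(i <- s | P i) coefs (F i) n.
Proof. by elim/big_rec2: _ => // i _ f _ <-. Qed.

Lemma fps_unitE f : (f \is a GRing.unit) = (coefs f 0 \is a GRing.unit).
Proof. by []. Qed.

Lemma coefs_mulX f n : coefs (fpsX * f) n = if n is m.+1 then coefs f m else 0.
Proof. by rewrite fps_mulX. Qed.

Lemma coefs_mulXn k f n : coefs (fpsX ^+ k * f) n =
  if (k <= n)%N then coefs f (n - k) else 0.
Proof.
elim: k n => [|k IHk] n; first by rewrite expr0 mul1r subn0.
by rewrite exprS -mulrA coefs_mulX; case: n => [|n] //; rewrite IHk subSS.
Qed.

Lemma coefs_pointed f n : coefs (pointed f) n = coefs f n *+ n.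
Proof. by rewrite /pointed coefs_mulX; case: n. Qed.

Lemma fps_divX_pointed f : fps_divX (pointed f) = fps_deriv f.
Proof. by apply/fpsP=> n; rewrite [LHS](coefs_pointed f n.+1). Qed.

Lemma fps_derivD f g : fps_deriv (f + g) = fps_deriv f + fps_deriv g.
Proof. by apply/fpsP=> n; rewrite coefsD /= mulrnDl. Qed.

Lemma fps_derivN f : fps_deriv (- f) = - fps_deriv f.
Proof. by apply/fpsP=> n /=; rewrite mulNrn. Qed.

Lemma fps_deriv1 : fps_deriv (1 : fps R) = 0.
Proof. by apply/fpsP=> n /=; rewrite mul0rn. Qed.

Lemma fps_derivX : fps_deriv (fpsX : fps R) = 1.
Proof. by apply/fpsP=> -[|n] /=; rewrite ?mulr1n // mul0rn. Qed.

Lemma fps_derivM f g : fps_deriv (f * g) = fps_deriv f * g + f * fps_deriv g.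
Proof.
apply/fpsP=> n; rewrite coefsD !coefsM [LHS]/=.
transitivity (\sum_(i < n.+2) (coefs f i *+ i * coefs g (n.+1 - i)%N
                              + coefs f i * (coefs g (n.+1 - i)%N *+ (n.+1 - i)))).
  rewrite -sumrMnl; apply: eq_bigr => i _.
  by rewrite mulrnAl mulrnAr -mulrnDr subnKC // -ltnS.
rewrite big_split /=; congr (_ + _).
  by rewrite big_ord_recl mulr0n mul0r add0r; apply: eq_bigr.
rewrite big_ord_recr /= subnn mulr0n mulr0 addr0; apply: eq_bigr => i _.
by rewrite subSn // -ltnS.
Qed.

Lemma fps_nat_unit k : (k%:R : R) \is a GRing.unit -> (k%:R : fps R) \is a GRing.unit.
Proof. by rewrite fps_unitE coefsMn coefs1. Qed.

Definition fpsC c : fps R := Fps (fun n => if n is 0 then c else 0).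

Lemma fpsC_additive : zmod_morphism fpsC.
Proof. by move=> c d; apply/fpsP=> -[|n] /=; rewrite ?subr0. Qed.

Lemma coefs_fpsCM c f n : coefs (fpsC c * f) n = c * coefs f n.
Proof.
rewrite coefsM big_ord_recl subn0 /= big1 ?addr0 // => i _.
by rewrite mul0r.
Qed.

Lemma fpsC_multiplicative : monoid_morphism fpsC.
Proof.
split=> [|c d]; first by apply/fpsP=> -[].
by apply/fpsP=> n; rewrite coefs_fpsCM; case: n => //= n; rewrite mulr0.
Qed.

HB.instance Definition _ := GRing.isZmodMorphism.Build R (fps R) fpsC fpsC_additive.
HB.instance Definition _ := GRing.isMonoidMorphism.Build R (fps R) fpsC
  fpsC_multiplicative.

Lemma fps_derivC c : fps_deriv (fpsC c) = 0.
Proof. by apply/fpsP=> n /=; rewrite mul0rn. Qed.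

End SeriesTheory.

(* Evaluation at z = Z of a series in x whose coefficients are polynomials in  *)
(* z: as each coefficient is a polynomial, Z may have a nonzero constant term. *)
Section Evaluation.
Variables (R : idomainType) (Z : fps R).

Definition eval_coef : {poly R} -> fps R :=
  horner_morph (fun c : R => mulrC Z (fpsC c)).
HB.instance Definition _ := GRing.RMorphism.on eval_coef.

Definition eval_poly : {poly {poly R}} -> fps R :=
  horner_morph (fun q : {poly R} => mulrC fpsX (eval_coef q)).
HB.instance Definition _ := GRing.RMorphism.on eval_poly.

Lemma eval_coefX : eval_coef 'X = Z. Proof. exact: horner_morphX. Qed.
Lemma eval_coefC c : eval_coef c%:P = fpsC c. Proof. exact: horner_morphC. Qed.
Lemma eval_polyX : eval_poly 'X = fpsX. Proof. exact: horner_morphX. Qed.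
Lemma eval_polyC q : eval_poly q%:P = eval_coef q. Proof. exact: horner_morphC. Qed.

Lemma eval_polyMXn P n : eval_poly (P * 'X^n) = fpsX ^+ n * eval_poly P.
Proof. by rewrite rmorphM rmorphXn /= eval_polyX mulrC. Qed.

Lemma eval_poly_scale c n : eval_poly (c%:P *: 'X^n) = fpsC c * (fpsX ^+ n * 1).
Proof. by rewrite -mul_polyC eval_polyMXn eval_polyC eval_coefC mulr1 mulrC. Qed.

(** The difference is a multiple of the power n + 1 of the outer variable, which is sent to x. Hence
    the truncation in [eval] below may be taken at any order >= n, and [eval] respects sums and
    products. *)
Lemma coefs_eval_poly (P Q : {poly {poly R}}) n :
  (forall i, (i <= n)%N -> P`_i = Q`_i) -> coefs (eval_poly P) n =
    coefs (eval_poly Q) n.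
Proof.
move=> PQ; apply/eqP; rewrite -subr_eq0 -coefsN -coefsD.
have -> : eval_poly P - eval_poly Q = eval_poly (P - Q) by rewrite rmorphB.
rewrite -[P - Q](poly_take_drop n.+1).
have -> : take_poly n.+1 (P - Q) = 0.
  apply/polyP=> i; rewrite coef_take_poly coef0 ltnS; case: ifP => // lein.
  by rewrite coefB PQ // subrr.
by rewrite add0r eval_polyMXn coefs_mulXn ltnn.
Qed.

Definition eval (F : fps {poly R}) : fps R :=
  Fps (fun n => coefs (eval_poly (\poly_(i < n.+1) coefs F i)) n).

Lemma evalE (F : fps {poly R}) n m : (n <= m)%N ->
  coefs (eval F) n = coefs (eval_poly (\poly_(i < m.+1) coefs F i)) n.
Proof.
move=> nm; apply: coefs_eval_poly => i lein.
by rewrite !coef_poly !ltnS lein (leq_trans lein).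
Qed.

Lemma evalD F G : eval (F + G) = eval F + eval G.
Proof.
apply/fpsP=> n; rewrite coefsD /= -coefsD -rmorphD.
apply: coefs_eval_poly => i lein.
by rewrite coefD !coef_poly ltnS lein.
Qed.

Lemma evalM F G : eval (F * G) = eval F * eval G.
Proof.
apply/fpsP=> n; rewrite coefsM.
transitivity (coefs (eval_poly (\poly_(i < n.+1) coefs F i *
  \poly_(i < n.+1) coefs G i)) n).
  apply: coefs_eval_poly => i lein; rewrite coef_poly ltnS lein coefM coefsM.
  apply: eq_bigr => j _; have lej : (j <= i)%N by rewrite -ltnS.
  by rewrite !coef_poly !ltnS (leq_trans lej) // (leq_trans (leq_subr _ _)).
rewrite rmorphM coefsM; apply: eq_bigr => i _.
by rewrite -!evalE ?leq_subr // -ltnS.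
Qed.

Lemma evalN F : eval (- F) = - eval F.
Proof.
apply/fpsP=> n; rewrite coefsN /= -coefsN -rmorphN.
apply: coefs_eval_poly => i lein.
by rewrite coefN !coef_poly ltnS lein.
Qed.

Lemma eval_series (f : nat -> R) : eval (Fps (fun n => (f n)%:P)) = Fps f.
Proof.
apply/fpsP=> n; rewrite /= poly_def rmorph_sum coefs_sum.
rewrite (bigD1 ord_max) //= big1 ?addr0 => [|i ne].
  by rewrite eval_poly_scale coefs_fpsCM coefs_mulXn leqnn subnn mulr1.
rewrite eval_poly_scale coefs_fpsCM coefs_mulXn -ltnS ltn_ord coefs1 subn_eq0.
rewrite leqNgt ltn_neqAle -ltnS ltn_ord andbT.
by rewrite -(inj_eq val_inj) /= in ne; rewrite ne mulr0.
Qed.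

Lemma eval1 : eval 1 = 1.
Proof.
rewrite (_ : 1 = Fps (fun n => ((n == 0%N)%:R : R)%:P)) ?eval_series //.
by apply/fpsP=> n; rewrite coefs1 /= rmorph_nat.
Qed.

Lemma evalX : eval fpsX = fpsX.
Proof.
rewrite (_ : fpsX = Fps (fun n => ((n == 1%N)%:R : R)%:P)) ?eval_series //.
by apply/fpsP=> n; rewrite /= rmorph_nat.
Qed.

Lemma eval_var : eval (fpsC 'X) = Z.
Proof.
apply/fpsP=> n; transitivity (coefs (eval_poly ('X%:P)) n).
  by apply: coefs_eval_poly => -[|i] lein; rewrite coef_poly coefC ltnS lein.
by rewrite eval_polyC eval_coefX.
Qed.

Lemma coefs_eval0 F c : coefs F 0 = c%:P -> coefs (eval F) 0 = c.
Proof.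
move=> F0; have -> : coefs (eval F) 0 = coefs (eval_poly (c%:P)%:P) 0.
  by apply: coefs_eval_poly => -[|i] // _; rewrite coef_poly coefC F0.
by rewrite eval_polyC eval_coefC.
Qed.

End Evaluation.

(** * The series of triangulations *)

(** By [disk_count_out] nothing is cut off at 3v, so the coefficient of each power of x is a
    polynomial in z and [eval] applies. *)
Definition disk_series : fps {poly rat} :=
  Fps (fun v => \poly_(p < 3 * v) (disk_count v p)%:R).

Lemma coefs_disk_series v p : (coefs disk_series v)`_p = (disk_count v p)%:R.
Proof. by rewrite coef_poly; case: ltnP => // le; rewrite disk_count_out //; lia. Qed.

Lemma coefs_triangulation_series n : coefs triangulation_series n = (disk_count n 1)%:R.
Proof. by rewrite -num_triangulations_disk /=; case: ifP. Qed.

Notation zvar := (fpsC ('X : {poly rat})).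

Definition lift_series (f : fps rat) : fps {poly rat} := Fps (fun n => (coefs f n)%:P).

Lemma fpsC_exp (q : {poly rat}) k : fpsC q ^+ k = fpsC (q ^+ k).
Proof. by rewrite rmorphXn. Qed.

(** The coefficient of z^0 says W_0 = x, that of z^1 says W_1 = T, and that of z^(p+2) is
    [disk_count_step]. *)
Lemma disk_equation :
  zvar ^+ 3 * (disk_series * disk_series) + (1 - zvar) * disk_series =
  (1 - zvar) * fpsX + zvar * lift_series triangulation_series.
Proof.
have wE := coefs_disk_series; have tE := coefs_triangulation_series.
move: disk_series triangulation_series wE tE => W T wE tE.
rewrite !mulrBl !mul1r fpsC_exp; apply/fpsP=> v; apply/polyP=> p.
rewrite !coefsD !coefsN !coefs_fpsCM coefsM !coefD !coefN.
rewrite (mulrC 'X^3) !(mulrC 'X) coefMXn !coefMX.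
have cX k : (coefs (fpsX : fps {poly rat}) v)`_k = ((v == 1%N) && (k == 0%N))%:R.
  by rewrite /=; case: (v == 1%N); rewrite ?coef1 ?coef0.
rewrite !cX wE.
case: p => [|p] /=; first by rewrite eqxx andbT add0r !subr0 ?addr0 disk_count_vertex.
rewrite andbF sub0r wE coefC.
case: p => [|p] /=; first by rewrite add0r eqxx andbT disk_count_vertex tE addrC.
set c := (if _ then _ else _).
suff -> : c = (\sum_(u < v.+1) \sum_(j < p) disk_count u j *
  disk_count (v - u) (p.-1 - j))%:R.
  by rewrite andbF oppr0 addr0 (disk_count_step v p) natrD; ring.
rewrite {}/c.
case: p => [|p] /=; first by rewrite big1 // => u _; rewrite big_ord0.
rewrite coef_sum natr_sum; apply: eq_bigr => u _.
rewrite coefM natr_sum !subSS subn0; apply: eq_bigr => j _.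
by rewrite !wE natrM.
Qed.

Lemma fps_deriv_lift f : fps_deriv (lift_series f) = lift_series (fps_deriv f).
Proof. by apply/fpsP=> n /=; rewrite rmorphMn. Qed.

Lemma disk_count1v p : disk_count 1 p = (p == 0%N).
Proof.
by case: p => [|p]; [rewrite disk_count_vertex | rewrite disk_count_out //; lia].
Qed.

Lemma coefs_triangulation2 : coefs triangulation_series 2 = 1.
Proof.
rewrite coefs_triangulation_series disk_count_step big1 ?addn0; last first.
  by move=> u _; rewrite big_ord0.
rewrite disk_count_step; have -> : disk_count 2 3 = 0%N by exact: stub_count1.
by rewrite !big_ord_recl !big_ord0 /= !disk_count_vertex.
Qed.

(** * Elimination of the disk series by the kernel method *)

Section Clairaut.
Let T := triangulation_series.
Let S := fps_deriv T.
Let Z := (1 - S)^-1.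

Lemma coefs_deriv0 : coefs S 0 = 0.
Proof.
by rewrite /S /= mulr1n.
Qed.

Lemma unit_1B_deriv : 1 - S \is a GRing.unit.
Proof. by rewrite fps_unitE coefsD coefsN coefs_deriv0 coefs1 subr0 unitr1. Qed.

Lemma eval_pointK : (1 - S) * Z = 1.
Proof. by rewrite mulrV // unit_1B_deriv. Qed.

Lemma clairaut : 4%:R * T = 4%:R * (fpsX * S) - S ^+ 2 * (1 - S) ^+ 2.
Proof.
have [z3 z3E] : exists z3, z3 = zvar ^+ 3 by exists (zvar ^+ 3).
have dz3 : fps_deriv z3 = 0 by rewrite z3E fpsC_exp fps_derivC.
have dE := congr1 (@fps_deriv _) disk_equation; rewrite -z3E in dE.
rewrite !(fps_derivD, fps_derivM, fps_derivN, fps_deriv1, fps_derivC, fps_derivX,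
  fps_deriv_lift) in dE.
rewrite dz3 -/T -/S in dE.
set W := disk_series in dE; set W' := fps_deriv W in dE.
have E1 : (2%:R * z3 * W + (1 - zvar)) * W' = (1 - zvar) + zvar * lift_series S.
  transitivity (0 * (W * W) + z3 * (W' * W + W * W') + ((0 - 0) * W + (1 - zvar) * W')).
    by ring.
  by rewrite dE; ring.
have evl f : eval Z (lift_series f) = f by rewrite eval_series; case: f.
have ev_exp F k : eval Z (F ^+ k) = eval Z F ^+ k.
  by elim: k => [|k IHk]; rewrite ?expr0 ?eval1 // !exprS evalM IHk.
have ev2 : eval Z 2%:R = 2%:R by rewrite mulr2n evalD !eval1.
(* The constant term of dW/dx is the coefficient of x in W, which is 1 since the only disk with one
   vertex has no edge. *)
have W'u : eval Z W' \is a GRing.unit.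
  rewrite fps_unitE (@coefs_eval0 _ _ _ 1) ?unitr1 //.
  apply/polyP=> p; rewrite [coefs W' 0]/= mulr1n -/(coefs disk_series 1).
  by rewrite coefs_disk_series disk_count1v coefC; case: p.
have := congr1 (eval Z) E1; rewrite z3E.
rewrite !(evalD, evalM, evalN, eval1, eval_var, ev_exp, evl, ev2).
(* The choice of Z makes the right-hand side vanish; as the second factor on the left is a unit, the
   kernel 2 Z^3 w + 1 - Z vanishes. *)
have -> : 1 - Z + Z * S = 0.
  by rewrite -{1}eval_pointK; ring.
set w := eval Z W => eW.
have {}eW : 2%:R * Z ^+ 3 * w = Z - 1.
  apply/eqP; rewrite -subr_eq0 opprB -(mulIr_eq0 _ (mulIr W'u)).
  by rewrite eW.
have := congr1 (eval Z) disk_equation.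
rewrite !(evalD, evalM, evalN, eval1, eval_var, ev_exp, evl, evalX) -/W -/w -/T => eT.
have zS : Z - 1 = Z * S by rewrite -{1}eval_pointK; ring.
(* Multiplied by 4 Z^3, the left side of the disk equation depends on w only through 2 Z^3 w, which
   equals Z - 1. *)
have e4 : 4%:R * Z ^+ 3 * (Z ^+ 3 * (w * w) + (1 - Z) * w) = - (Z - 1) ^+ 2.
  transitivity ((2%:R * Z ^+ 3 * w) ^+ 2 + 2%:R * (1 - Z) * (2%:R * Z ^+ 3 * w));
    first by ring.
  by rewrite eW; ring.
move: e4; rewrite eT zS => e4.
have e5 : 1 - Z = - (Z * S) by rewrite -zS; ring.
rewrite e5 in e4.
have U4 : (1 - S) ^+ 4 * Z ^+ 4 = 1 by rewrite -exprMn eval_pointK expr1n.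
have U2 : (1 - S) ^+ 2 * Z ^+ 2 = 1 by rewrite -exprMn eval_pointK expr1n.
have e6 : 4%:R * (T - fpsX * S) = - ((1 - S) ^+ 2 * S ^+ 2).
  transitivity (4%:R * ((1 - S) ^+ 4 * Z ^+ 4) * (T - fpsX * S));
    first by rewrite U4 mulr1.
  transitivity ((1 - S) ^+ 4 * (4%:R * Z ^+ 3 * (- (Z * S) * fpsX + Z * T)));
    first by ring.
  rewrite e4; transitivity (- ((1 - S) ^+ 2 * ((1 - S) ^+ 2 * Z ^+ 2) * S ^+ 2));
    first by ring.
  by rewrite U2 mulr1.
transitivity (4%:R * (T - fpsX * S) + 4%:R * (fpsX * S)); first by ring.
by rewrite e6; ring.
Qed.

(* The derivative of Clairaut's equation factors through the unit S'.          *)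
Lemma fpsX_derivE : 4%:R * fpsX = 2%:R * S * (1 - S) * (1 - 2%:R * S).
Proof.
have [c cE] : exists c : fps rat, c = 4%:R by exists 4%:R.
have dc : fps_deriv c = 0 by rewrite cE -(rmorph_nat (@fpsC rat)) fps_derivC.
have dE := congr1 (@fps_deriv _) clairaut; rewrite -cE !expr2 in dE.
rewrite !(fps_derivD, fps_derivM, fps_derivN, fps_deriv1, fps_derivX) dc -/S in dE.
set S' := fps_deriv S in dE.
(* The constant term of S' is 2 T_2 = 2. *)
have S'u : S' \is a GRing.unit.
  have d2 (f : fps rat) : coefs (fps_deriv (fps_deriv f)) 0 = coefs f 2 *+ 2 by [].
  have S'0 := d2 T; rewrite coefs_triangulation2 -/S -/S' in S'0.
  by rewrite fps_unitE S'0 unitfE.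
apply/eqP; rewrite -subr_eq0 -(mulIr_eq0 _ (mulIr S'u)); apply/eqP.
rewrite -cE; have e : (c * fpsX - 2%:R * S * (1 - S) * (1 - 2%:R * S)) * S' =
  (0 * (fpsX * S) + c * (1 * S + fpsX * S') -
   ((S' * S + S * S') * ((1 - S) * (1 - S)) +
     S * S * ((0 - S') * (1 - S) + (1 - S) * (0 - S')))) - (0 * T + c * S) by ring.
by rewrite e -dE subrr.
Qed.

(** After multiplication by 4 (1 - S), [clairaut] replaces 4T and [fpsX_derivE] replaces 4x, and
    both sides become the same polynomial in S. *)
Lemma triangulation_equation_holds : triangulation_equation T.
Proof.
rewrite /triangulation_equation fps_divX_pointed -/S /pointed -/S.
have u4 : (4%:R : fps rat) \is a GRing.unit by apply: fps_nat_unit.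
apply: (mulIr unit_1B_deriv); rewrite -!mulrA mulVr ?unit_1B_deriv // mulr1.
apply: (mulIr u4).
transitivity (4%:R * (3%:R * (fpsX * S)) * (1 - S) - 4%:R * (4%:R * T) * (1 - S));
  first by ring.
transitivity (2%:R * (4%:R * fpsX) * S - 2%:R * (4%:R * T)); last by ring.
rewrite clairaut.
transitivity (- (4%:R * fpsX) * S * (1 - S) + 4%:R * S ^+ 2 * (1 - S) ^+ 3);
  first by ring.
transitivity (2%:R * S ^+ 2 * (1 - S) ^+ 2); last by ring.
by rewrite fpsX_derivE; ring.
Qed.

End Clairaut.

(** Once the unit denominator is cleared, the coefficient of x^n reads (3n - 4) F_n - sum = 2 (n -
    1) F_n, that is (n - 2) F_n = sum. *)
Lemma triangulation_equationP (F : fps rat) : in_x2 F ->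
  triangulation_equation F <-> triangulation_recursion (coefs F).
Proof.
move=> F2; have [F0 F1] := F2; have U := unit_1B_pointed F2.
have eqU : triangulation_equation F <->
    (3%:R * pointed F - 4%:R * F) * (1 - fps_divX (pointed F)) = 2%:R * (pointed F - F).
  rewrite /triangulation_equation; split=> [->|e];
    first by rewrite -!mulrA mulVr ?mulr1.
  by apply: (mulIr U); rewrite e -!mulrA mulVr ?mulr1.
have cA n : coefs (3%:R * pointed F - 4%:R * F) n = (3%:R * n%:R - 4%:R) * coefs F n.
  rewrite coefsD coefsN !mulr_natl !coefsMn coefs_pointed -(mulr_natl _ n); ring.
have cB n : coefs (2%:R * (pointed F - F)) n = 2%:R * (n%:R - 1) * coefs F n.
  rewrite mulr_natl coefsMn coefsD coefsN coefs_pointed -(mulr_natl _ n); ring.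
have cAU n : coefs ((3%:R * pointed F - 4%:R * F) * (1 - fps_divX (pointed F))) n =
   (3%:R * n%:R - 4%:R) * coefs F n - \sum_(2 <= k < n)
      (3%:R * k%:R - 4%:R) * (n.+1 - k)%:R * coefs F k * coefs F (n.+1 - k)%N.
  rewrite mulrBr mulr1 coefsD coefsN cA; congr (_ - _).
  (* The terms k = 0, 1 and n of the convolution vanish because F_0 = F_1 = 0. *)
  rewrite coefsM fps_divX_pointed big_ord_recr /= subnn F1 mulr1n mulr0 addr0.
  rewrite -(big_mkord xpredT (fun k => coefs (3%:R * pointed F - 4%:R * F) k *
    (coefs F (n - k).+1 *+ (n - k).+1))).
  transitivity (\sum_(0 <= k < n) (3%:R * k%:R - 4%:R) * (n.+1 - k)%:R *
    coefs F k * coefs F (n.+1 - k)%N).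
    apply: eq_big_nat => k /andP[_ kn]; rewrite cA subSn; last exact: ltnW.
    by rewrite -(mulr_natl _ (n - k).+1); ring.
  case: n => [|[|n]]; first by rewrite !big_geq.
    by rewrite big_nat1 [RHS]big_geq // F0 mulr0 mul0r.
  by rewrite (@big_ltn _ _ _ 0%N n.+2) // (@big_ltn _ _ _ 1%N n.+2) //
    F0 F1 !mulr0 !mul0r !add0r.
rewrite eqU; split=> [e n n3|rec].
  have := congr1 (fun f => coefs f n) e; rewrite cAU cB => en.
  have n2 : (n%:R - 2%:R : rat) != 0.
    by rewrite subr_eq0 (Num.Theory.eqr_nat rat n 2) neq_ltn n3 orbT.
  apply: (mulfI n2); rewrite mulVKf //.
  transitivity ((3%:R * n%:R - 4%:R) * coefs F n - 2%:R * (n%:R - 1) * coefs F n);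
    first by ring.
  by rewrite -en; ring.
apply/fpsP=> n; rewrite cAU cB.
(* For n = 2 both sides equal 2 F_2, so the equation leaves the coefficient of x^2 free. *)
have [n3|n3] := leqP 3 n; last first.
  rewrite [X in _ - X]big_geq // subr0.
  by case: n n3 => [|[|[|n]]] // _; rewrite ?F0 ?F1 ?mulr0 //; ring.
have n2 : (n%:R - 2%:R : rat) != 0.
  by rewrite subr_eq0 (Num.Theory.eqr_nat rat n 2) neq_ltn n3 orbT.
have := rec n n3 => en.
set s := \sum_(_ <= _ < _) _ in en *.
have -> : s = (n%:R - 2%:R) * coefs F n by rewrite en mulVKf.
ring.
Qed.

(** In the recursion for n both k and n + 1 - k lie between 2 and n - 1, so strong induction applies
    from the common coefficient of x^2. *)
Lemma triangulation_recursion_unique (F G : fps rat) : in_x2 F -> in_x2 G ->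
  coefs F 2 = coefs G 2 -> triangulation_recursion (coefs F) ->
  triangulation_recursion (coefs G) -> F = G.
Proof.
case=> F0 F1 [G0 G1] FG2 rF rG; apply/fpsP=> n.
have [m] := ubnP n; elim: m n => // m IHm [|[|[|n]]] nm; rewrite ?F0 ?F1 //.
rewrite rF // rG //; congr (_ * _); apply: eq_big_nat => k /andP[k2 kn].
by rewrite !IHm //; lia.
Qed.

Theorem theorem2 :
  [/\ triangulation_equation triangulation_series,
      (forall F : fps rat,
         [/\ in_x2 F, coefs F 2 = 1 & triangulation_equation F] <->
         F = triangulation_series)
    & (forall F : fps rat, in_x2 F ->
         triangulation_equation F <-> triangulation_recursion (coefs F))].
Proof.
have T2 : in_x2 triangulation_series by [].
split; [exact: triangulation_equation_holds | move=> F;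
  split | exact: triangulation_equationP].
  move=> [F2 F21 eF]; apply: triangulation_recursion_unique => //.
  - by rewrite F21 coefs_triangulation2.
  - by apply/triangulation_equationP.
  by apply/triangulation_equationP => //; exact: triangulation_equation_holds.
move=> ->; split=> //; first exact: coefs_triangulation2.
exact: triangulation_equation_holds.
Qed.
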